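(* There are an exponential function $\mathfrak a(\cdot,\cdot,\cdot)$ and a double exponential function $\mathfrak i(\cdot,\cdot,\cdot,\cdot)$ such that the following holds. Let $\Sigma$ be a Boolean algebra (written as an algebra of sets) with largest element $\Omega$ and smallest element $\emptyset$, let $\mu:\Sigma\to[0,1]$ be additive with $\mu(\Omega)=1$, let $(\rho_n)_n$, $(\lambda_p)_p$ be sequences of additive functions $\Sigma\to\mathbb R$, with products $\rho_n\lambda_p$, and let $B$ be a positive integer. Suppose that: (1) each sequence $(\rho_n\lambda_p)_p$ (for fixed $n$) and each sequence $(\rho_n\lambda_p)_n$ (for fixed $p$) has bounded fluctuations with the uniform bound $8B^2E^2$; (2) for all $n$, $\rho_n$ has a modulus of continuity $\omega_{\rho_n}$ with $\omega_{\rho_n}(E)\le E2^n$ for all $E$, and for all $p$, $\lambda_p$ has a modulus of continuity $\omega_{\lambda_p}$ with $\omega_{\lambda_p}(E)\le E2^p$ for all $E$; (3) $\|\rho_n\|_{L^1}\le B$ for all $n$ and $\|\lambda_p\|_{L^1}\le B$ for all $p$; (4) for any $E,D$, any $\nu$ among the $\rho_n$ and $\lambda_p$, and any partition $\mathcal B$, there are a partition $\mathcal B'\succeq\mathcal B$ and a subset $\mathcal B''\subseteq\mathcal B'$ such that $\nu$ is $E$-constant on $\mathcal B'\setminus\mathcal B''$, $\mu(\mathcal B'')<1/D$, and $|\mathcal B'|\le 2BDE|\mathcal B|$. Then for every $E$ there exist $m<s$ and $q<l$ such that, with $C=2^{29}B^6E^6$ and $\mathbf w_j$ the functions (depending on $B,E,\mathfrak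 a,\mathfrak i$) defined in the context, $$s\le\mathbf w_{2^{20}B^4E^4}^{\,C+2}(1),\qquad l\le\mathbf w_{2^{20}B^4E^4}^{\,C+2}(1),\qquad \bigl|(\rho_m\lambda_s)(\Omega)-(\rho_l\lambda_q)(\Omega)\bigr|<\frac{20}{E}.$$
   Context: $E,D$ range over positive integers and all indices over natural numbers. Superscripts on functions $\mathbb N\to\mathbb N$ denote iteration. Given $B,E$ and $C=2^{29}B^6E^6$, define $\mathbf w_0(m)=m+1$ and $$\mathbf w_{j+1}(m)=\mathbf w_j^{\,N(m)}(m),\qquad N(m)=\mathfrak a(B,E2^{m+5},BE)\,C^2+\mathfrak i(B,E2^{m+5},E2^{m+5},E)\,C.$$ A function $h(x)$ is exponential if there are $a,b,c,d$ with $h(x)\le a^{bx^c+d}$ for all $x$, and double exponential if there are $a,b,c,d$ with $h(x)\le a^{a^{bx^c+d}}$ for all $x$; a function $h(x_1,\dots,x_k)$ is exponential (resp. double exponential) if there is an exponential (resp. double exponential) $h'$ with $h(x_1,\dots,x_k)\le h'(\prod_i x_i)$ for all $x_1,\dots,x_k$. $\nu:\Sigma\to\mathbb R$ is additive if $\nu(\emptyset)=0$ and $\nu(\sigma\cup\tau)=\nu(\sigma)+\nu(\tau)-\nu(\sigma\cap\tau)$ for all $\sigma,\tau\in\Sigma$. A partition is a finite set $\mathcal A\subseteq\Sigma$ of pairwise disjoint elements (its union need not be $\Omega$); for a function $\nu$ on $\Sigma$, $\nu(\mathcal A)=\sum_{\sigma\in\mathcal A}\nu(\sigma)$ and $|\nu|(\mathcal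 A)=\sum_{\sigma\in\mathcal A}|\nu(\sigma)|$. $|\mathcal B|$ is the number of elements of a partition $\mathcal B$. $\mathcal A\preceq\mathcal B$ (equivalently $\mathcal B\succeq\mathcal A$) means $\bigcup\mathcal A=\bigcup\mathcal B$ and every element of $\mathcal B$ is contained in an element of $\mathcal A$. $\|\nu\|_{L^1}=\sup_{\mathcal A}|\nu|(\mathcal A)$ over all partitions $\mathcal A$. $\omega:\mathbb N\to\mathbb N$ is a modulus of continuity for $\nu$ if for every $E$ and every partition $\mathcal A$ with $\mu(\mathcal A)<1/\omega(E)$, $|\nu|(\mathcal A)<1/E$. $(\nu_n)_n$ has bounded fluctuations with bound $V(E)$ if for every $E$, every monotone $\mathbf m:\mathbb N\to\mathbb N$ with $\mathbf m(i)\ge i$ for all $i$, every $n$ and every $\sigma\in\Sigma$ there is an $m^*\in[n,\mathbf m^{V(E)}(n)]$ such that $|\nu_j(\sigma)-\nu_{j'}(\sigma)|<1/E$ whenever $j,j'\in[m^*,\mathbf m(m^* )]$. For functions $\rho,\lambda$ on $\Sigma$, $(\rho\ast\lambda)(\sigma)=\rho(\sigma)\lambda(\sigma)/\mu(\sigma)$. The product $\rho\lambda$ is $(\rho\lambda)(\sigma)=\lim_{\mathcal A\succeq\{\sigma\}}(\rho\ast\lambda)(\mathcal A)$; when $\rho(\sigma)=\int_\sigma f\,d\mu$ and $\lambda(\sigma)=\int_\sigma g\,d\mu$, this is $(\rho\lambda)(\sigma)=\int_\sigma fg\,d\mu$. $\nu$ is $E$-constant on $\mathcal B$ if for every $\sigma\in\mathcal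 B$ and every additive $\lambda$, $|(\nu\lambda)(\sigma)-(\nu\ast\lambda)(\sigma)|<|\lambda(\sigma)|/E$.
   Formalization: In the definition of E-constant, ''<'' is read as ''≤'' (with ''<'', taking λ = 0 gives 0 < 0, so hypothesis (4) could never hold), and ''every additive λ'' means every additive λ for which the product νλ is defined. *)

(* Defs.v *)
From mathcomp Require Import all_boot all_order all_algebra finmap.
From mathcomp Require Import all_classical all_reals all_analysis.
Import numFieldNormedType.Exports.
Set Implicit Arguments.
Unset Strict Implicit.
Unset Printing Implicit Defensive.
Import Order.TTheory GRing.Theory Num.Theory.

Local Open Scope fset_scope.
Local Open Scope classical_set_scope.
Local Open Scope ring_scope.

Definition exponential (h : nat -> nat) : Prop :=
  exists a b c d : nat, forall x, (h x <= a ^ (b * x ^ c + d))%N.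

Definition double_exponential (h : nat -> nat) : Prop :=
  exists a b c d : nat, forall x, (h x <= a ^ (a ^ (b * x ^ c + d)))%N.

Definition exponential3 (h : nat -> nat -> nat -> nat) : Prop :=
  exists2 h', exponential h' &
    forall x1 x2 x3, (h x1 x2 x3 <= h' (x1 * x2 * x3))%N.

Definition double_exponential4 (h : nat -> nat -> nat -> nat -> nat) : Prop :=
  exists2 h', double_exponential h' &
    forall x1 x2 x3 x4, (h x1 x2 x3 x4 <= h' (x1 * x2 * x3 * x4))%N.

Definition cstC (B E : nat) : nat := (2 ^ 29 * B ^ 6 * E ^ 6)%N.

Definition w_iterations (a : nat -> nat -> nat -> nat)
    (i : nat -> nat -> nat -> nat -> nat) (B E m : nat) : nat :=
  (a B (E * 2 ^ (m + 5)) (B * E) * cstC B E ^ 2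
   + i B (E * 2 ^ (m + 5)) (E * 2 ^ (m + 5)) E * cstC B E)%N.

Fixpoint w_fun (a : nat -> nat -> nat -> nat)
    (i : nat -> nat -> nat -> nat -> nat) (B E j m : nat) : nat :=
  if j is j'.+1 then iter (w_iterations a i B E m) (w_fun a i B E j') m else m.+1.

(* An abstract Boolean algebra is a [ctbDistrLatticeType]: the empty set is
   [\bot], the whole space [\top], and inclusion is the lattice order. *)
Section BooleanAlgebra.
Context {R : realType} {d : Order.disp_t} {S : ctbDistrLatticeType d}.
Implicit Types (mu nu rho lam : S -> R) (s t : S) (A : {fset S}).

Definition fin_additive nu : Prop :=
  nu \bot%O = 0 /\
  forall s t, nu (s `|` t)%O = nu s + nu t - nu (s `&` t)%O.

Definition is_partition A : Prop :=
  {in A &, forall s t, s != t -> (s `&` t)%O = \bot%O}.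

Definition sum_on nu A : R := \sum_(s <- A) nu s.

Definition abs_sum_on nu A : R := \sum_(s <- A) `|nu s|.

(* [refined_by A1 A2] is the relation written A1 <~ A2 (A2 is finer). *)
Definition refined_by (A1 A2 : {fset S}) : Prop :=
  (\join_(s <- A1) s)%O = (\join_(s <- A2) s)%O /\
  forall t, t \in A2 -> exists2 s, s \in A1 & (t <= s)%O.

Definition L1_norm nu : \bar R :=
  ereal_sup [set (abs_sum_on nu A)%:E | A in is_partition].

(* Positivity of [omega E] is explicit because 0^-1 = 0 would make the
   condition void at [omega E = 0]. *)
Definition modulus_of_continuity mu nu (omega : nat -> nat) : Prop :=
  forall E, (0 < E)%N -> (0 < omega E)%N /\
    forall A, is_partition A -> sum_on mu A < (omega E)%:R^-1 ->
      abs_sum_on nu A < E%:R^-1.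

Definition bounded_fluctuations (nu_ : nat -> S -> R) (V : nat -> nat) : Prop :=
  forall E, (0 < E)%N ->
  forall m : nat -> nat, {homo m : i j / (i <= j)%N} ->
    (forall i, i <= m i)%N ->
  forall (n : nat) s, exists2 m' : nat, (n <= m' <= iter (V E) m n)%N &
    forall j j', (m' <= j <= m m')%N -> (m' <= j' <= m m')%N ->
      `|nu_ j s - nu_ j' s| < E%:R^-1.

Definition star_product mu rho lam s : R := rho s * lam s / mu s.

(* The filter of the net of partitions refining [{s}], directed by refinement. *)
Definition refinements s : set_system {fset S} :=
  filter_from [set A0 | is_partition A0 /\ refined_by [fset s]%fset A0]
    (fun A0 => [set A | is_partition A /\ refined_by A0 A]).

Definition lim_product mu rho lam s : R :=
  lim (sum_on (star_product mu rho lam) A @[A --> refinements s]).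

(* [lim_product] is meaningful only where this holds: [star_product] is 0/0 (and
   evaluates to 0) on the null elements, and the limit must exist. *)
Definition product_defined mu rho lam : Prop :=
  (forall s, mu s = 0 -> rho s = 0 /\ lam s = 0) /\
  forall s, cvg (sum_on (star_product mu rho lam) A @[A --> refinements s]).

(* The inequality is non-strict: [lam = 0] is additive, so with [<] no function
   would be E-constant on a nonempty partition. *)
Definition E_constant mu (E : nat) nu A : Prop :=
  forall s, s \in A ->
  forall lam, fin_additive lam -> product_defined mu nu lam ->
    `|lim_product mu nu lam s - star_product mu nu lam s| <= `|lam s| / E%:R.

End BooleanAlgebra.

(* Main.v *)
(** Suppose that [(rho_n lam_q)(Omega)] and [(rho_p lam_q)(Omega)] stay apart for
    all [n < q < p] up to the bound.  On a fine enough finite partition all the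
    functions have densities, and convex combinations of the densities of the [rho_n]
    with almost minimal energy (a Huber energy, defined on L^1) are close to each
    other off a set [A] of small measure.  Take one combination [h] with indices below
    [q] and one [h'] with indices above [q].  Since the integrals of [h lam_q] and
    [h' lam_q] are apart, some [rho_n lam_q] or [rho_p lam_q] is large on a subset of
    [A], a "hump".  A hump can be added to or removed from any set already built so as
    to create one more jump of [n |-> (rho_n lam_q)(sigma)], or of
    [q |-> (rho_p lam_q)(sigma)], without spoiling the earlier jumps: by a gliding-hump
    argument of the same kind, the earlier measures are small on small sets.  Too many
    jumps contradict the uniform fluctuation bound.  Each hump restricts the admissible
    indices to a subset, which is kept large at a level of the hierarchy [w_j]. *)
Require Import Defs.
From mathcomp Require Import all_boot all_order all_algebra finmap.
From mathcomp Require Import all_classical all_reals all_analysis.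
From mathcomp Require Import finset finmap zify lra ring.
Import numFieldNormedType.Exports.
Set Implicit Arguments.
Unset Strict Implicit.
Unset Printing Implicit Defensive.
Import Order.TTheory GRing.Theory Num.Theory.
Local Open Scope ring_scope.

(** * Large sets of indices *)

Section Largeness.
Implicit Types (L : nat -> nat -> Prop) (h : nat -> nat) (S : nat -> Prop).

Fixpoint chain L (c x z : nat) : Prop :=
  if c is c'.+1 then exists2 y, L x y & chain L c' y z else (x <= z)%N.

(* [large h S j x z] is a relative of the Ketonen-Solovay notion of an
   [omega^j]-large set, for the part of [S] in the interval (x, z].  The cut points
   need not belong to [S], so a 2-colouring costs only a splitting of the base
   function [h] into a sum and no level. *)
Fixpoint large h S (j x z : nat) : Prop :=
  if j is j'.+1 then chain (large h S j') (h x) x z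
  else exists s, [/\ (x < s)%N, (s <= z)%N & S s].

Lemma chain_le L c x z :
  (forall u v, L u v -> (u <= v)%N) -> chain L c x z -> (x <= z)%N.
Proof.
move=> Lle; elim: c x => [//|c IH] x /= [y /Lle xy /IH]; exact: leq_trans.
Qed.

Lemma large_le h S j x z : large h S j x z -> (x <= z)%N.
Proof.
elim: j x z => [|j IH] x z /=; first by case=> s [/ltnW xs sz _]; exact: leq_trans sz.
exact: chain_le.
Qed.

(** Moving the start down from [x] to [x'] lengthens the first interval, so the comparison of [L]
    with [L'] allows a smaller left end [u']. *)
Lemma chain_sub L L' c c' x x' z z' :
  (forall u v, L u v -> (u <= v)%N) ->
  (forall u u' v, (x <= u)%N -> (x' <= u' <= u)%N -> (v <= z)%N -> L u v -> L' u' v) ->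
  (c' <= c)%N -> (x' <= x)%N -> (z <= z')%N -> chain L c x z -> chain L' c' x' z'.
Proof.
move=> Lle; elim: c c' x x' => [|c IH] [|c'] x x' //= sub cc xx zz.
- by move=> xz; lia.
- by case=> y /Lle xy /(chain_le Lle) yz; lia.
case=> y Lxy cyz; have xy := Lle _ _ Lxy; have yz := chain_le Lle cyz.
exists y; first by apply: sub Lxy => //; rewrite leqnn.
by apply: (IH c' y y) => // u u' v yu yu' vz; apply: sub => //; lia.
Qed.

Lemma large_sub h h' S S' j x x' z z' :
  {homo h' : a b / (a <= b)%N} -> (forall t, (x' <= t)%N -> (h' t <= h t)%N) ->
  (forall s, (x < s <= z)%N -> S s -> S' s) ->
  (x' <= x)%N -> (z <= z')%N -> large h S j x z -> large h' S' j x' z'.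
Proof.
move=> hh; elim: j x x' z z' => [|j IH] x x' z z' hle sub xx zz /=.
  case=> s [xs sz Ss]; exists s; split; [lia|lia|].
  by apply: sub => //; lia.
apply: chain_sub => //; first exact: large_le.
  move=> u u' v xu xu' vz; apply: IH => //; try lia.
    by move=> t ut; apply: hle; lia.
  by move=> s us; apply: sub; lia.
by apply: leq_trans (hle _ xx); apply: hh.
Qed.

(** Pigeonhole: of [a + b - 1] intervals, [a] have the first colour or [b] the second. Intervals of
    the wrong colour are absorbed by starting the next one of the right colour earlier. *)
Lemma chain_split L L1 L2 c a b x z :
  (forall u v, L u v -> (u <= v)%N) ->
  (forall u v, L1 u v -> (u <= v)%N) -> (forall u v, L2 u v -> (u <= v)%N) ->
  (forall u u' v, (u' <= u)%N -> L1 u v -> L1 u' v) ->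
  (forall u u' v, (u' <= u)%N -> L2 u v -> L2 u' v) ->
  (forall u v, (x <= u)%N -> (v <= z)%N -> L u v -> L1 u v \/ L2 u v) ->
  (a + b <= c.+1)%N -> chain L c x z -> chain L1 a x z \/ chain L2 b x z.
Proof.
move=> Lle Lle1 Lle2 low1 low2.
elim: c a b x => [|c IH] a b x col ab ch; have xz := chain_le Lle ch.
  by case: a ab => [|a] ab; [left|right; have -> : b = 0%N by lia].
case: a ab => [|a] ab; first by left.
case: b ab => [|b] ab; first by right.
case: ch => y Lxy cyz; have xy := Lle _ _ Lxy; have yz := chain_le Lle cyz.
have col' u v : (y <= u)%N -> (v <= z)%N -> L u v -> L1 u v \/ L2 u v.
  by move=> yu; apply: col; lia.
case: (col _ _ (leqnn x) yz Lxy) => H.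
- have ab' : (a + b.+1 <= c.+1)%N by lia.
  case: (IH a b.+1 y col' ab' cyz) => H'; [left; by exists y|right].
  by apply: chain_sub H' => // u u' v _ /andP[_ uu] _; apply: low2.
- have ab' : (a.+1 + b <= c.+1)%N by lia.
  case: (IH a.+1 b y col' ab' cyz) => H'; [left|right; by exists y].
  by apply: chain_sub H' => // u u' v _ /andP[_ uu] _; apply: low1.
Qed.

Lemma large_low h S j u u' v : {homo h : a b / (a <= b)%N} ->
  (u' <= u)%N -> large h S j u v -> large h S j u' v.
Proof. by move=> hh uu; apply: large_sub. Qed.

(** Induction on the level: each interval of the chain is large in one of the two colours, and
    [chain_split] then selects [h1 x] intervals of the first or [h2 x] of the second. *)
Lemma large_split h h1 h2 S S1 S2 j x z :
  {homo h1 : a b / (a <= b)%N} -> {homo h2 : a b / (a <= b)%N} ->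
  (forall t, (x <= t)%N -> (h1 t + h2 t <= h t)%N) ->
  (forall s, (x < s <= z)%N -> S s -> S1 s \/ S2 s) ->
  large h S j x z -> large h1 S1 j x z \/ large h2 S2 j x z.
Proof.
move=> hh1 hh2; elim: j x z => [|j IH] x z hle col /=.
  case=> s [xs sz /col[]]; first by lia.
  - by left; exists s.
  - by right; exists s.
apply: chain_split; try exact: large_le.
- by move=> u u' v; apply: large_low.
- by move=> u u' v; apply: large_low.
- move=> u v xu vz; apply: IH => [t ut|s us]; first by apply: hle; lia.
  by apply: col; lia.
- by apply: leqW; apply: hle.
Qed.

(** Induction on the number of colours: the last one is split off with base [h'], and the rest of
    [h] serves the others. *)
Lemma large_color h h' S (C : nat -> nat -> Prop) k j x z :
  {homo h' : a b / (a <= b)%N} ->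
  (forall t, (x <= t)%N -> (k.+1 * h' t <= h t)%N) ->
  (forall s, (x < s <= z)%N -> S s -> exists2 i, (i <= k)%N & C i s) ->
  large h S j x z -> exists2 i, (i <= k)%N & large h' (C i) j x z.
Proof.
move=> hh; elim: k h S => [|k IH] h S hle col lg.
  exists 0%N => //; apply: large_sub lg => // [t xt|s xs /col[]//].
    by rewrite -[h' t]mul1n; apply: hle.
  by move=> i; rewrite leqn0 => /eqP ->.
pose S1 s := exists2 i, (i <= k)%N & C i s.
have [||||lg1|lg2] := @large_split h (fun t => k.+1 * h' t)%N h' S S1 (C k.+1) j x z _ _ _ _ lg.
- by move=> a b ab; rewrite leq_mul2l hh.
- by [].
- by move=> t xt; rewrite addnC -mulSn; apply: hle.
- move=> s xs /col[//|i]; rewrite leq_eqVlt => /orP[/eqP ->|]; first by right.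
  by rewrite ltnS => ik; left; exists i.
- case: (IH _ _ _ _ lg1) => [//|//|i ik Ci].
  by exists i => //; apply: leqW.
- by exists k.+1.
Qed.

Lemma large_ex h S j x z : (forall t, (0 < h t)%N) -> large h S j x z ->
  exists s, [/\ (x < s)%N, (s <= z)%N & S s].
Proof.
move=> h0; elim: j x z => [//|j IH] x z /=.
case: (h x) (h0 x) => [//|c _] /= [y /IH[s [xs sy Ss]] /(chain_le (@large_le _ _ _)) yz].
by exists s; split=> //; apply: leq_trans yz.
Qed.

Lemma chain_cat L a b x z : chain L (a + b) x z ->
  exists2 y, chain L a x y & chain L b y z.
Proof.
elim: a x => [|a IH] x /=; first by exists x.
by case=> y Lxy /IH[y' ? ?]; exists y' => //; exists y.
Qed.

Lemma chain_pieces L k c x z : (forall u v, L u v -> (u <= v)%N) ->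
  chain L (k * c) x z ->
  exists u : nat -> nat, [/\ u 0%N = x, (u k <= z)%N &
    forall i, (i < k)%N -> chain L c (u i) (u i.+1)].
Proof.
move=> Lle; elim: k x => [|k IH] x /=; first by exists (fun=> x).
rewrite mulSn => /chain_cat[y cxy /IH[u [u0 ukz uP]]].
exists (fun i => if i is i'.+1 then u i' else x); split=> // -[|i] ik.
  by rewrite u0.
by apply: uP.
Qed.

Lemma large_level h S j j' x z : {homo h : a b / (a <= b)%N} -> (forall t, (0 < h t)%N) ->
  (j' <= j)%N -> large h S j x z -> large h S j' x z.
Proof.
move=> hh h0; elim: j x z => [|j IH] x z; first by rewrite leqn0 => /eqP ->.
rewrite leq_eqVlt => /orP[/eqP -> //|]; rewrite ltnS => jj /=.
case: (h x) (h0 x) => [//|c _] /= [y /(IH _ _ jj) lg /(chain_le (@large_le _ _ _)) yz].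
by apply: large_sub lg.
Qed.
End Largeness.

(** * Humps *)

Section Humps.
Context {R : realFieldType} {T : finType}.
Implicit Types (w : nat -> T -> R) (A : {set T}) (l : seq nat).

Definition wsum (f : T -> R) A : R := \sum_(t in A) f t.

Lemma wsumID f A A' : wsum f A = wsum f (A :&: A') + wsum f (A :\: A').
Proof. by rewrite /wsum (big_setID A'). Qed.

Lemma wsum_setU f A A' : wsum f (A' :|: A) = wsum f A' + wsum f (A :\: A').
Proof. by rewrite (wsumID f _ A') (setIidPr (subsetUl A' A)) setDUl setDv set0U. Qed.

(* Among [V + 1] consecutive index intervals, one carries no jump of size [c]. *)
Definition fluct_bound w (V : nat) (c : R) (L : nat) : Prop :=
  forall A (x y : nat -> nat),
    (forall i, (i <= V)%N -> (x i <= y i)%N) ->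
    (forall i, (i < V)%N -> (y i <= x i.+1)%N) -> (y V <= L)%N ->
  exists2 i, (i <= V)%N & `|wsum (w (x i)) A - wsum (w (y i)) A| < c.

(* Lists of humps are listed with the latest (largest) index first. *)
Definition jump w c A (y x : nat) : bool :=
  (x < y)%N && (c <= `|wsum (w y) A - wsum (w x) A|).

(** In a longer list the [V + 2] smallest indices bound [V + 1] consecutive intervals with a jump on
    each. *)
Lemma jumps_bounded w V c L A l :
  fluct_bound w V c L -> sorted (jump w c A) l -> all (fun n => n <= L)%N l ->
  (size l <= V.+1)%N.
Proof.
move=> fb sl al; rewrite leqNgt; apply/negP => Vl.
pose s := rev l.
have sz : size s = size l by rewrite size_rev.
have /(sortedP 0%N) ss : sorted (fun x y => jump w c A y x) s by rewrite rev_sorted.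
have js i : (i <= V)%N -> jump w c A (nth 0%N s i.+1) (nth 0%N s i).
  by move=> iV; apply: ss; rewrite sz; lia.
have [|//||i iV] := fb A (nth 0%N s) (fun i => nth 0%N s i.+1).
- by move=> i /js /andP[/ltnW].
- have /allP : all (fun n => n <= L)%N s by rewrite all_rev.
  by apply; apply: mem_nth; rewrite sz.
- by rewrite distrC ltNge; have /andP[_ ->] := js i iV.
Qed.

(* Adding or removing [s] changes the earlier values by at most [k], while the two
   options differ by at least [e] for the new index. *)
Lemma hump_step w (k c c' e : R) A (s : {set T}) l y :
  0 <= k -> c' <= c - 2 * k -> c' <= e / 2 - k ->
  sorted (jump w c A) l -> all (fun x => x < y)%N l ->
  (forall x, x \in l -> forall A', A' \subset s -> `|wsum (w x) A'| <= k) ->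
  e <= `|wsum (w y) s| ->
  exists A', sorted (jump w c' A') (y :: l).
Proof.
move=> k0 c'c c'e sl al small big.
have keep A' : (A' = A :|: s) \/ (A' = A :\: s) ->
    forall x, x \in l -> `|wsum (w x) A' - wsum (w x) A| <= k.
  move=> A'E x xl; case: A'E => ->.
    rewrite wsum_setU (addrC (wsum (w x) A)) addrK.
    by apply: small => //; apply: subsetDl.
  rewrite (wsumID (w x) A s) addrC opprD subrK normrN.
  by apply: small => //; apply: subsetIr.
have sorted' A' : (A' = A :|: s) \/ (A' = A :\: s) -> sorted (jump w c' A') l.
  move=> /keep kp; apply: (sub_in_sorted (P := mem l) _ _ sl); last first.
    by apply/allP => x.
  move=> u v ul vl /andP[vu cuv]; rewrite /jump vu /=.
  have := kp _ ul; have := kp _ vl; move: cuv c'c.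
  rewrite !ler_norml ler_normr => h1 h2 h3 h4.
  rewrite ler_normr; move: h1 h3 h4 => /orP[] ? /andP[? ?] /andP[? ?]; apply/orP; [left|right]; lra.
case: l sl al small keep sorted' => [|x l] sl al small keep sorted'; first by exists A.
have xy : (x < y)%N by case/andP: al.
have xl : x \in x :: l by rewrite inE eqxx.
have diff : wsum (w y) (A :|: s) - wsum (w y) (A :\: s) = wsum (w y) s.
  by rewrite setUC wsum_setU; lra.
have k1 := keep _ (or_introl erefl) x xl; have k2 := keep _ (or_intror erefl) x xl.
suff [H|H] : c' <= `|wsum (w y) (A :|: s) - wsum (w x) (A :|: s)| \/
       c' <= `|wsum (w y) (A :\: s) - wsum (w x) (A :\: s)|.
- exists (A :|: s); rewrite /= in sorted' *; rewrite sorted' ?andbT; last by left.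
  by rewrite /jump xy.
- exists (A :\: s); rewrite /= in sorted' *; rewrite sorted' ?andbT; last by right.
  by rewrite /jump xy.
(* If both options failed, [wsum (w y) s], the difference of the two values at [y], would be smaller
   than [2 * c' + 2 * k <= e]. *)
apply: contrapT => /not_orP[/negP h1 /negP h2].
move: h1 h2 k1 k2 big; rewrite -!ltNge !ltr_norml !ler_norml ler_normr -diff.
move=> /andP[? ?] /andP[? ?] /andP[? ?] /andP[? ?] /orP[] ?; lra.
Qed.

(** Absolute continuity of the weight [f] with respect to [m], at one fixed pair of scales. *)
Definition good (m : T -> R) (k e : R) (f : T -> R) : Prop :=
  forall A, wsum m A < e -> `|wsum f A| < k.

Lemma not_good m k e f : ~ good m k e f ->
  exists A, wsum m A < e /\ k <= `|wsum f A|.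
Proof.
move=> /existsNP[A /not_implyP[mA /negP]]; rewrite -leNgt => kA; by exists A.
Qed.

Lemma good_weaken m k e e' f : e' <= e -> good m k e f -> good m k e' f.
Proof. by move=> ee g A /lt_le_trans/(_ ee)/g. Qed.

Lemma wsum_sub (m : T -> R) A A' : (forall t, 0 <= m t) -> A' \subset A ->
  wsum m A' <= wsum m A.
Proof.
move=> m0 /setIidPr AA; rewrite (wsumID m A A') AA lerDl.
by apply: sumr_ge0 => t _.
Qed.

(* A weight sequence that is equicontinuous at no scale [eta s] would allow a new
   hump for each of the [V + 2] blocks, contradicting the fluctuation bound. *)
Lemma equicontinuous_subset (m : T -> R) w V c L (k1 k2 : R) (eta : nat -> R) h S j x z :
  (forall t, 0 <= m t) -> fluct_bound w V c L ->
  0 <= k2 -> c <= k1 / 2 - 2 * k2 * V.+2%:R ->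
  (forall s q A, (x <= s)%N -> (q <= s)%N -> wsum m A < eta s -> `|wsum (w q) A| <= k2) ->
  {homo eta : a b / (a <= b)%N >-> b <= a} ->
  {homo h : a b / (a <= b)%N} -> (forall t, (0 < h t)%N) -> (z <= L)%N ->
  (forall s, S s -> (x < s <= z)%N) ->
  large (fun t => (2 * V.+2).+1 * 2 ^ V.+2 * h t)%N S j.+1 x z ->
  exists y S', [/\ (x <= y)%N, (forall s, S' s -> S s /\ (y < s <= z)%N),
    large h S' j y z & forall q, S' q -> good m k1 (eta y) (w q)].
Proof.
move=> m0 fb k20 ck eta_small eta_mono hh h0 zL Sz lg.
(* [cc n] is the jump size that survives [n] humps: a further hump changes each earlier jump by at
   most [2 * k2]. *)
pose cc (n : nat) : R := k1 / 2 - 2 * k2 * n%:R.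
have ccS n : cc n.+1 <= cc n - 2 * k2 by rewrite /cc -natr1; lra.
have ccS' n : cc n.+1 <= k1 / 2 - k2.
  by have := mulr_ge0 k20 (ler0n R n); rewrite /cc -natr1; lra.
pose hk k := (fun t => 2 ^ k * h t)%N.
have hkh k : {homo hk k : a b / (a <= b)%N} by move=> a b ab; rewrite leq_mul2l hh ?orbT.
(* Here [l] lists the humps found, [S1] holds the indices still admissible, each with its own set
   [A], and [k] counts the rounds left. A round spends one interval on choosing the next index and
   another on possible good indices, and it halves the base [hk]. *)
suff claim k l y S1 : (size l + k = V.+2)%N -> (x <= y)%N ->
    all (fun n => n <= y)%N l -> (y <= z)%N ->
    (forall s, S1 s -> S s /\ (y < s <= z)%N) ->
    (forall q, S1 q -> exists A, sorted (jump w (cc (size l)) A) (q :: l)) ->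
    chain (large (hk k) S1 j) (2 * k).+1 y z ->
    exists y' S', [/\ (x <= y')%N, (forall s, S' s -> S s /\ (y' < s <= z)%N),
      large h S' j y' z & forall q, S' q -> good m k1 (eta y') (w q)].
  apply: (claim V.+2 [::] x S) => //.
  - exact: large_le lg.
  - by move=> s Ss; split=> //; apply: Sz.
  - by move=> q _; exists set0.
  - apply: (chain_sub (@large_le _ _ _) _ _ _ _ lg) => //.
    + move=> u u' v _ /andP[_ uu] _; apply: large_sub => // t _.
      by rewrite /hk leq_mul2r; apply/orP; right; rewrite mulSn leq_addr.
    + by rewrite -mulnA leq_pmulr // muln_gt0 expn_gt0 h0.
elim: k l y S1 => [|k IH] l y S1 szl xy ly yz S1S ext ch.
  case: ch => /= y1 lg1 y1z; exfalso.
  have hk0 t : (0 < hk 0%N t)%N by rewrite /hk expn0 mul1n.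
  have [s [ys sy1 S1s]] := large_ex hk0 lg1.
  have [A sA] := ext _ S1s.
  move: szl; rewrite addn0 => szl.
  have fb' : fluct_bound w V (cc (size l)) L.
    move=> A' x' y' h1 h2 h3; have [i iV lt] := fb A' x' y' h1 h2 h3.
    by exists i => //; apply: lt_le_trans lt _; rewrite /cc szl.
  have := jumps_bounded fb' sA; rewrite /= szl.
  have -> : (s <= L)%N by lia.
  have -> : all (fun n => n <= L)%N l.
    by apply: sub_all ly => n ny; lia.
  by move=> /(_ isT); lia.
have [y1 lg1 ch1] : exists2 y1, large (hk k.+1) S1 j y y1 &
    chain (large (hk k.+1) S1 j) (2 * k.+1) y1 z := ch.
have hk0 k' t : (0 < hk k' t)%N by rewrite /hk muln_gt0 expn_gt0 h0.
have [s [ys sy1 S1s]] := large_ex (hk0 _) lg1.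
have [A0 sA0] := ext _ S1s.
have yy1 := large_le lg1.
have y1z := chain_le (@large_le _ _ _) ch1.
(* A set of measure below [eta s] is negligible for all indices up to [s], so a set witnessing that
   a later [q] is bad is a hump. One interval of good indices ends the search; otherwise all
   intervals but one have many bad indices, and [s] joins [l]. *)
pose G q := [/\ S1 q, (y1 < q <= z)%N & good m k1 (eta s) (w q)].
pose Bd q := [/\ S1 q, (y1 < q <= z)%N & ~ good m k1 (eta s) (w q)].
have [ch2|ch2] : chain (large (hk k) G j) 1 y1 z \/
    chain (large (hk k) Bd j) (2 * k).+1 y1 z.
  apply: (chain_split (@large_le _ _ _) (@large_le _ _ _) (@large_le _ _ _)
    _ _ _ _ ch1); last lia.
  - by move=> u u' v; apply: large_low; apply: hkh.
  - by move=> u u' v; apply: large_low; apply: hkh.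
  - move=> u v y1u vz; apply: large_split => // [t _|q uqv S1q].
      by rewrite /hk expnS mul2n -addnn mulnDl.
    have qz : (y1 < q <= z)%N by lia.
    by case: (pselect (good m k1 (eta s) (w q))) => gq; [left|right].
- case: ch2 => y2 lg2 y2z; exists y1, G; split=> //.
  + lia.
  + by move=> q [/S1S[Sq _] qz _].
  + apply: large_sub lg2 => // t _; rewrite /hk.
    by rewrite -{1}[h t]mul1n leq_mul2r expn_gt0 orbT.
  + by move=> q [_ _]; apply: good_weaken; apply: eta_mono.
- apply: (IH (s :: l) y1 Bd) => //.
  + by rewrite /=; lia.
  + lia.
  + by rewrite /= sy1; apply: sub_all ly => n ny; lia.
  + by move=> q [/S1S[Sq _] qz _].
  + move=> q [S1q qz /not_good[A [mA kA]]].
    apply: (hump_step k20 (ccS _) (ccS' _) sA0 _ _ kA).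
      rewrite /=; apply/andP; split; first lia.
      by apply: sub_all ly => n ny; lia.
    move=> n nl A' AA'; apply: (eta_small s); first lia.
      move: nl; rewrite inE => /orP[/eqP -> //|/(allP ly)]; lia.
    by apply: le_lt_trans mA; apply: wsum_sub.
Qed.
End Humps.

(** * Convex combinations of almost minimal energy *)

Section Energy.
Context {R : realFieldType} {T : finType}.
Implicit Types (f : nat -> T -> R) (S : nat -> Prop) (h : T -> R) (A : {set T}).

(* Midpoints suffice: only sets closed under averaging two elements are needed. *)
Inductive hull f S : (T -> R) -> Prop :=
| hull_base n : S n -> hull f S (f n)
| hull_mid h h' : hull f S h -> hull f S h' -> hull f S (fun t => (h t + h' t) / 2).

Lemma hull_sub f S S' h : (forall n, S n -> S' n) -> hull f S h -> hull f S' h.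
Proof. by move=> SS; elim=> [n /SS|h1 h2 _ ? _ ?]; [apply: hull_base|apply: hull_mid]. Qed.

Lemma hull_near f S h (u : T -> R) (v c : R) :
  (forall n, S n -> `|\sum_t f n t * u t - v| <= c) -> hull f S h ->
  `|\sum_t h t * u t - v| <= c.
Proof.
move=> Sc; elim=> [n /Sc //|h1 h2 _ H1 _ H2].
have -> : \sum_t (h1 t + h2 t) / 2 * u t =
    (\sum_t h1 t * u t + \sum_t h2 t * u t) / 2.
  by rewrite -big_split mulr_suml; apply: eq_bigr => t _ /=; lra.
move: H1 H2; rewrite !ler_norml => /andP[? ?] /andP[? ?]; apply/andP; split; lra.
Qed.

(* Quadratic for the strict convexity, linear at infinity to be bounded on L^1. *)
Definition huber (K x : R) : R := if `|x| <= K then x ^+ 2 else 2 * K * `|x| - K ^+ 2.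

(** [huber K] is the upper envelope of the tangents to the square at the points of [[-K, K]]; with
    [huber_support] this yields convexity. *)
Lemma huber_tangent K x s : `|s| <= K -> 2 * s * x - s ^+ 2 <= huber K x.
Proof.
rewrite /huber => sK; case: ifPn => [_|]; first by have := sqr_ge0 (x - s); nra.
rewrite -ltNge => Kx.
have : s * x <= `|s| * `|x| by rewrite -normrM ler_norm.
rewrite -(real_normK (num_real s)); have := normr_ge0 s; nra.
Qed.

Lemma huber_small K x : `|x| <= K -> huber K x = x ^+ 2.
Proof. by rewrite /huber => ->. Qed.

Lemma huber_ge0 K x : 0 <= K -> 0 <= huber K x.
Proof.
by move=> K0; have := @huber_tangent K x 0; rewrite normr0 mulr0 mul0r expr0n subrr; apply.
Qed.

Lemma huber_le K x : 0 <= K -> huber K x <= 2 * K * `|x|.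
Proof.
rewrite /huber => K0; case: ifP => [xK|_]; last by have := sqr_ge0 K; lra.
by rewrite -(real_normK (num_real x)); have := normr_ge0 x; nra.
Qed.

Lemma huber_support K x : 0 <= K -> exists2 s, `|s| <= K & huber K x = 2 * s * x - s ^+ 2.
Proof.
move=> K0; rewrite /huber; case: ifPn => [xK|]; first by exists x => //; lra.
rewrite -ltNge => Kx; case: (lerP 0 x) => x0.
  by exists K; rewrite ger0_norm.
by exists (- K); [rewrite normrN ger0_norm|rewrite ltr0_norm //; lra].
Qed.

Lemma huber_mid K x y : 0 <= K -> huber K ((x + y) / 2) <= (huber K x + huber K y) / 2.
Proof.
move=> K0; have [s sK ->] := huber_support ((x + y) / 2) K0.
have := huber_tangent x sK; have := huber_tangent y sK; lra.
Qed.

Variable m : T -> R.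
Hypothesis m0 : forall t, 0 <= m t.

Definition energy K h : R := \sum_t m t * huber K (h t).

Definition norm1 h : R := \sum_t m t * `|h t|.

Lemma hull_norm1 f S h B : (forall n, norm1 (f n) <= B) -> hull f S h -> norm1 h <= B.
Proof.
move=> fB; elim=> [//|h1 h2 _ H1 _ H2].
apply: (@le_trans _ _ ((norm1 h1 + norm1 h2) / 2)); last by lra.
rewrite /norm1 -big_split mulr_suml; apply: ler_sum => t _ /=.
have : `|(h1 t + h2 t) / 2| <= (`|h1 t| + `|h2 t|) / 2.
  by rewrite normrM (@ger0_norm _ 2^-1) ?invr_ge0 ?ler0n // ler_pM2r ?invr_gt0 // ler_normD.
have := m0 t; nra.
Qed.

Lemma energy_ge0 K h : 0 <= K -> 0 <= energy K h.
Proof. by move=> K0; apply: sumr_ge0 => t _; rewrite mulr_ge0 ?huber_ge0. Qed.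

Lemma energy_le K h : 0 <= K -> energy K h <= 2 * K * norm1 h.
Proof.
move=> K0; rewrite /norm1 mulr_sumr; apply: ler_sum => t _.
by rewrite mulrCA ler_wpM2l ?huber_le.
Qed.

(** Where both values are at most [K], the midpoint gap of the square is [(h t - h' t) ^+ 2 / 4],
    which is at least [d ^+ 2 / 4] on the set. Where one exceeds [K], Markov's inequality applies.
    By convexity no point contributes negatively. *)
Lemma energy_gap K d h h' : 0 < K -> 0 < d ->
  wsum m [set t | d <= `|h t - h' t|] <= (norm1 h + norm1 h') / K +
    4 / d ^+ 2 * ((energy K h + energy K h') / 2 - energy K (fun t => (h t + h' t) / 2)).
Proof.
move=> K0 d0; rewrite /norm1 /energy /wsum -!big_split !mulr_suml -sumrB mulr_sumr -big_split.
rewrite big_mkcond; apply: ler_sum => t _ /=; rewrite inE.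
set x := h t; set y := h' t.
have gap0 : 0 <= (m t * huber K x + m t * huber K y) / 2 - m t * huber K ((x + y) / 2).
  have := huber_mid x y (ltW K0); have := m0 t; nra.
have n0 : 0 <= (m t * `|x| + m t * `|y|) / K.
  by rewrite divr_ge0 ?addr_ge0 ?mulr_ge0 // ltW.
have d4 : 0 <= 4 / d ^+ 2 by rewrite divr_ge0 ?sqr_ge0.
case: ifP => [dxy|_]; last by rewrite addr_ge0 // mulr_ge0.
have [xK|xK] := lerP `|x| K; last first.
  rewrite -[leLHS]addr0; apply: lerD; last exact: mulr_ge0.
  rewrite ler_pdivlMr //.
  have := m0 t; have := normr_ge0 y; nra.
have [yK|yK] := lerP `|y| K; last first.
  rewrite -[leLHS]addr0; apply: lerD; last exact: mulr_ge0.
  rewrite ler_pdivlMr //.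
  have := m0 t; have := normr_ge0 x; nra.
have zK : `|(x + y) / 2| <= K.
  by move: xK yK; rewrite !ler_norml => /andP[? ?] /andP[? ?]; apply/andP; split; lra.
rewrite !huber_small // -[leLHS]add0r; apply: lerD => //.
rewrite [leRHS](_ : _ = m t * ((x - y) ^+ 2 / d ^+ 2)); last by field; rewrite gt_eqF.
rewrite ler_peMr // ler_pdivlMr ?exprn_gt0 // mul1r.
by rewrite -(real_normK (num_real (x - y))) ler_sqr ?nnegrE // ltW.
Qed.
End Energy.

(** * The finite model *)

Lemma last_true (P : nat -> Prop) k : P 0%N -> ~ P k ->
  exists l, [/\ (l < k)%N, P l & ~ P l.+1].
Proof.
move=> P0; elim: k => [//|k IH] nP; case: (pselect (P k)) => [Pk|/IH[l [lk Pl nPl]]].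
  by exists k.
by exists l; split=> //; apply: leqW.
Qed.

Lemma homo_upto (u : nat -> nat) k : (forall i, (i < k)%N -> (u i <= u i.+1)%N) ->
  forall i j, (i <= j)%N -> (j <= k)%N -> (u i <= u j)%N.
Proof.
move=> uS i; elim=> [|j IH]; first by rewrite leqn0 => /eqP ->.
rewrite leq_eqVlt => /orP[/eqP -> //|]; rewrite ltnS => ij jk.
by apply: leq_trans (uS _ jk); apply: IH => //; apply: ltnW.
Qed.

Section Core.
Context {R : realFieldType} {T : finType}.
Implicit Types (S I : nat -> Prop) (A : {set T}) (l : seq nat).

(** An unstable pair in each of the [V + 1] pieces would give consecutive intervals with a jump on
    each, against [fluct_bound]. *)
Lemma stable_piece (w : nat -> T -> R) V c L A (u : nat -> nat) :
  fluct_bound w V c L -> (forall i, (i < V.+1)%N -> (u i <= u i.+1)%N) -> (u V.+1 <= L)%N ->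
  exists2 i, (i <= V)%N & forall a b, (u i < a <= u i.+1)%N -> (u i < b <= u i.+1)%N ->
    `|wsum (w a) A - wsum (w b) A| < c.
Proof.
move=> fb uS uL; apply: contrapT => no.
have bad i : exists p : nat * nat, (i <= V)%N ->
    [/\ (u i < p.1)%N, (p.1 <= p.2)%N, (p.2 <= u i.+1)%N &
      ~ `|wsum (w p.1) A - wsum (w p.2) A| < c].
  case: (leqP i V) => iV; last by exists (0%N, 0%N).
  apply: contrapT => nop; apply: no; exists i => // a b ua ub.
  apply: contrapT => nab; apply: nop.
  case: (leqP a b) => ab; first by exists (a, b) => _ /=; split=> //; lia.
  by exists (b, a) => _ /=; split=> //; rewrite 1?distrC //; lia.
have [p pP] := choice bad.
have [|||i iV] := fb A (fun i => (p i).1) (fun i => (p i).2).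
- by move=> i /pP[].
- move=> i iV; have [_ _ h1 _] := pP _ (ltnW iV); have [h2 _ _ _] := pP _ iV.
  exact: leq_trans h1 (ltnW h2).
- by have [_ _ h1 _] := pP _ (leqnn V); apply: leq_trans h1 uL.
- by have [_ _ _] := pP _ iV.
Qed.

Variables (m : T -> R) (f g : nat -> T -> R) (B : R) (L : nat).
Hypotheses (m0 : forall t, 0 <= m t) (B0 : 0 < B)
  (fB : forall n, norm1 m (f n) <= B) (gB : forall n, norm1 m (g n) <= B).

Definition nu (n q : nat) (t : T) : R := m t * f n t * g q t.

(** [V1] and [c1] limit the main humps, of size [e1]; [V2] and [c2] limit the auxiliary humps, of
    size [k1], that serve the equicontinuity of each main one. [k2] is the error on sets of measure
    below [eta s], and [d] is the required closeness of densities. *)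
Variables (V1 V2 : nat) (c1 c2 d e1 k1 k2 : R) (eta : nat -> R) (steps : nat -> nat).
Hypotheses (fluct1 : forall q, (q <= L)%N -> fluct_bound (nu^~ q) V1 c1 L)
  (fluct1' : forall n, (n <= L)%N -> fluct_bound (nu n) V1 c1 L)
  (fluct2 : forall q, (q <= L)%N -> fluct_bound (nu^~ q) V2 c2 L)
  (fluct2' : forall n, (n <= L)%N -> fluct_bound (nu n) V2 c2 L).
Hypotheses (eta0 : forall s, 0 < eta s) (eta_mono : {homo eta : a b / (a <= b)%N >-> b <= a})
  (eta_small : forall s n q A, (n <= s)%N -> (q <= s)%N -> wsum m A < eta s ->
     `|wsum (nu n q) A| <= k2).
Hypotheses (d0 : 0 < d) (k10 : 0 <= k1) (k20 : 0 <= k2)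
  (c1k1 : c1 <= e1 / 2 - 2 * k1 * (2 * V1 + 3)%:R)
  (c2k2 : c2 <= k1 / 2 - 2 * k2 * V2.+2%:R).
Hypotheses (steps_mono : {homo steps : a b / (a <= b)%N})
  (stepsP : forall s, 256 * B ^+ 2 < (steps s)%:R * (d ^+ 2 * eta s ^+ 2)).
Hypothesis separated : forall n q p : nat, (n < q)%N -> (q < p)%N -> (p <= L)%N ->
  d * B + 2 * e1 + 2 * c1 < `|wsum (nu n q) setT - wsum (nu p q) setT|.

Lemma nu_sum A (u : T -> R) q : (\sum_(t in A) m t * u t * g q t) =
  \sum_t u t * (if t \in A then m t * g q t else 0).
Proof.
rewrite big_mkcond; apply: eq_bigr => t _; case: ifP => _; last by rewrite mulr0.
by rewrite mulrCA mulrA.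
Qed.

Lemma hull_wsum S A h (v c : R) q :
  (forall n, S n -> `|wsum (nu n q) A - v| <= c) -> hull f S h ->
  `|\sum_(t in A) m t * h t * g q t - v| <= c.
Proof. by rewrite nu_sum => Sc; apply: hull_near => n /Sc; rewrite -nu_sum. Qed.

Lemma hull_good S A h e q : wsum m A < e -> (forall n, S n -> good m e1 e (nu n q)) ->
  hull f S h -> `|\sum_(t in A) m t * h t * g q t| <= e1.
Proof.
move=> mA gd hh; rewrite -[X in `|X|]subr0; apply: hull_wsum hh => n /gd gn.
by rewrite subr0 ltW // gn.
Qed.

Lemma hull_ex S h : hull f S h -> exists n, S n.
Proof. by elim=> [n Sn|//]; exists n. Qed.

(** Off the set where [h] and [h'] are [d] apart, their integrals against [g q] differ by at most
    [d * B]; on it, goodness bounds each by [e1]. By stability each full integral is within [c1] of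
    that of any single index, which contradicts [separated]. *)
Lemma not_both_good S S' h h' q e : (q <= L)%N ->
  (forall n, S n -> (n < q)%N) -> (forall n, S' n -> (q < n <= L)%N) ->
  hull f S h -> hull f S' h' ->
  (forall a b, S a -> S b -> `|wsum (nu a q) setT - wsum (nu b q) setT| < c1) ->
  (forall a b, S' a -> S' b -> `|wsum (nu a q) setT - wsum (nu b q) setT| < c1) ->
  wsum m [set t | d <= `|h t - h' t|] < e ->
  (forall n, S n -> good m e1 e (nu n q)) -> (forall n, S' n -> good m e1 e (nu n q)) ->
  False.
Proof.
move=> qL Sq S'q hh hh' st st' mA gd gd'.
have [n Sn] := hull_ex hh; have [p S'p] := hull_ex hh'.
have /andP[qp pL] := S'q _ S'p.
have := separated (Sq _ Sn) qp pL; rewrite ltNge => /negP[].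
set A := [set t | _] in mA.
have H1 := hull_wsum (fun a Sa => ltW (st a n Sa Sn)) hh.
have H2 := hull_wsum (fun a Sa => ltW (st' a p Sa S'p)) hh'.
have H3 := hull_good mA gd hh; have H4 := hull_good mA gd' hh'.
have H5 : `|\sum_(t in ~: A) m t * h t * g q t - \sum_(t in ~: A) m t * h' t * g q t| <= d * B.
  rewrite -sumrB; apply: le_trans (ler_norm_sum _ _ _) _.
  apply: (@le_trans _ _ (d * norm1 m (g q))); last by rewrite ler_wpM2l // ltW.
  rewrite /norm1 mulr_sumr [leLHS]big_mkcond; apply: ler_sum => t _.
  rewrite !inE -ltNge; case: ifP => [hd|_]; last by rewrite !mulr_ge0 // ltW.
  rewrite -mulrBl -mulrBr !normrM (ger0_norm (m0 t)) mulrAC mulrC.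
  by rewrite ler_wpM2r ?mulr_ge0 // ltW.
have spl u : \sum_(t in setT) m t * u t * g q t =
    \sum_(t in A) m t * u t * g q t + \sum_(t in ~: A) m t * u t * g q t.
  by rewrite (big_setID A) setTI setTD.
move: H1 H2 H3 H4 H5; rewrite !spl !ler_norml.
move=> /andP[? ?] /andP[? ?] /andP[? ?] /andP[? ?] /andP[? ?].
by apply/andP; split; lra.
Qed.

(** Room for one energy step, in units of the next base: [V1 + 1] below the indices [q], at most one
    for [q], and twice [V1 + 1] above, where a 2-colouring halves the supply. *)
Let W := (3 * V1.+1 + 1)%N.

(* [b l] is the base that is left after [l] steps of a descent to a subset whose hull
   has no element of energy below [l * th]; the last possible [l] gives a set [S'] all
   of whose large subsets have hull elements of energy within [th] of minimal. *)
Lemma new_hump S j x h : {homo h : a b / (a <= b)%N} -> (forall t, (0 < h t)%N) ->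
  (forall s, S s -> (x < s <= L)%N) ->
  large (fun t => W ^ steps x * (t.+1 * h t))%N S j.+2 x L ->
  exists a I p, [/\ (x < p <= a)%N, forall s, I s -> S s /\ (a < s <= L)%N,
    large h I j.+1 a L &
    (forall q, I q -> ~ good m e1 (eta x) (nu p q)) \/
    (forall q, I q -> ~ good m e1 (eta x) (nu q p))].
Proof.
move=> hh h0 Sx lg.
pose b (l t : nat) := (W ^ (steps x - l) * (t.+1 * h t))%N.
have W0 : (0 < W)%N by rewrite /W addn1.
have bh (l : nat) : {homo b l : u v / (u <= v)%N}.
  by move=> u v uv; rewrite leq_mul2l leq_mul ?orbT ?ltnS ?hh.
have b0 (l t : nat) : (0 < b l t)%N by rewrite !muln_gt0 expn_gt0 W0 h0.
have b_h (l t : nat) : (t.+1 * h t <= b l t)%N by rewrite leq_pmull // expn_gt0 W0.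
have b_h' (l t : nat) : (h t <= b l t)%N by apply: leq_trans (b_h _ _); rewrite leq_pmull.
(* With these values each of the two terms in [energy_gap] is at most [eta x / 4]. *)
pose K := 8 * B / eta x; pose th := d ^+ 2 * eta x / 16.
have K0 : 0 < K by rewrite divr_gt0 // mulr_gt0.
have th0 : 0 < th by rewrite divr_gt0 // mulr_gt0 // exprn_gt0.
pose P (l : nat) := exists S', [/\ forall s, S' s -> S s, large (b l) S' j.+2 x L &
  forall u, hull f S' u -> l%:R * th <= energy m K u].
have P0 : P 0%N.
  exists S; split=> //; first by rewrite /b subn0.
  by move=> u _; rewrite mul0r energy_ge0 // ltW.
(* By the L^1 bound an energy is at most [2 * K * B], which [stepsP] makes smaller than [steps x]
   times [th]. *)
have nP : ~ P (steps x).
  case=> S' [_ /(large_ex (b0 _))[s [_ _ Ss]] /(_ _ (hull_base f Ss))].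
  apply/negP; rewrite -ltNge; apply: le_lt_trans (energy_le m0 (f s) (ltW K0)) _.
  apply: (@le_lt_trans _ _ (2 * K * B)); first by rewrite ler_wpM2l // mulr_ge0 ?ltW.
  rewrite /K /th -subr_gt0.
  rewrite [ltRHS](_ : _ = ((steps x)%:R * (d ^+ 2 * eta x ^+ 2) - 256 * B ^+ 2) / (16 * eta x)).
    by rewrite divr_gt0 ?subr_gt0 ?mulr_gt0.
  by field; rewrite gt_eqF.
have [l [lT [S' [SS' lg' en']] nPl]] := last_true P0 nP.
have low S'' : (forall s, S'' s -> S' s) -> large (b l.+1) S'' j.+2 x L ->
    exists2 u, hull f S'' u & energy m K u < l.+1%:R * th.
  move=> S''S' lg''; apply: contrapT => no; apply: nPl; exists S''; split=> //.
    by move=> s /S''S' /SS'.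
  by move=> u hu; rewrite leNgt; apply/negP => eu; apply: no; exists u.
have bS t : b l t = (W * b l.+1 t)%N by rewrite /b -(subnSK lT) expnS -!mulnA.
pose c := b l.+1 x.
have c0 : (0 < c)%N by apply: b0.
have Lle := @large_le (b l) S' j.+1.
(* From bottom to top: [V1 + 1] groups of [c] intervals for the lower indices, one interval for [q],
   and [V1 + 1] groups of [2 * c] intervals for the upper indices. *)
have : chain (large (b l) S' j.+1) (V1.+1 * c + (1 + V1.+1 * (2 * c))) x L.
  apply: (chain_sub Lle _ _ _ _ lg') => //.
    by move=> u u' v _ /andP[_ uu] _; apply: large_low.
  rewrite bS -/c /W; move: (c) c0 => n n0; clear - n0; nia.
case/chain_cat=> y1 chN /chain_cat[y2 [y2' lgQ y2'y2] chT].
have y1y2' := Lle _ _ lgQ; rewrite /= in y2'y2.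
have [u [u0 uy1 uP]] := chain_pieces Lle chN.
have [v [v0 vL vP]] := chain_pieces Lle chT.
have uS i : (i < V1.+1)%N -> (u i <= u i.+1)%N by move=> /uP; apply: chain_le.
have vS i : (i < V1.+1)%N -> (v i <= v i.+1)%N by move=> /vP; apply: chain_le.
have umono := homo_upto uS; have vmono := homo_upto vS.
have xy1 : (x <= y1)%N.
  by rewrite -u0; apply: leq_trans uy1; apply: umono.
have uB i : (i <= V1)%N -> (x <= u i)%N /\ (u i.+1 <= y1)%N.
  move=> iV; rewrite -[x in (x <= _)%N]u0; split; first exact: umono (leqW iV).
  exact: leq_trans (umono i.+1 V1.+1 iV (leqnn _)) uy1.
have vB i : (i <= V1)%N -> (y2 <= v i)%N /\ (v i.+1 <= L)%N.
  move=> iV; rewrite -[y2 in (y2 <= _)%N]v0; split; first exact: vmono (leqW iV).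
  exact: leq_trans (vmono i.+1 V1.+1 iV (leqnn _)) vL.
have y2L : (y2 <= L)%N by rewrite -v0; apply: leq_trans vL; apply: vmono.
(* In [Mcase] the index [q] is bad with many first indices above it; in [Ncase] it is bad with some
   first index below it. *)
pose Mcase q k := large h (fun s => [/\ S' s, (v k < s <= L)%N & ~ good m e1 (eta x) (nu s q)])
  j.+1 (v k) L.
pose Ncase q := exists2 n, (x < n <= y1)%N & ~ good m e1 (eta x) (nu n q).
have dich q : (y1 < q <= y2')%N -> (exists2 k, (k <= V1)%N & Mcase q k) \/ Ncase q.
  move=> qy; have /andP[y1q qy2'] := qy; have qy2 := leq_trans qy2' y2'y2.
  have qL := leq_trans qy2 y2L.
  have [k kV stk] := stable_piece setT (fluct1 qL) vS vL.
  have [i iV sti] := stable_piece setT (fluct1 qL) uS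
    (leq_trans uy1 (leq_trans (leq_trans y1y2' y2'y2) y2L)).
  have [xui uiy1] := uB _ iV; have [y2vk vkL] := vB _ kV.
  pose G s := [/\ S' s, (v k < s <= v k.+1)%N & good m e1 (eta x) (nu s q)].
  pose Bd s := [/\ S' s, (v k < s <= v k.+1)%N & ~ good m e1 (eta x) (nu s q)].
  have [lgG|lgB] : chain (large (b l.+1) G j.+1) c (v k) (v k.+1) \/
      chain (large (b l.+1) Bd j.+1) c (v k) (v k.+1).
    apply: (chain_split (@large_le _ _ _) (@large_le _ _ _) (@large_le _ _ _)
      _ _ _ _ (vP _ kV)); last by rewrite addnn mul2n.
    - by move=> ? ? ?; apply: large_low.
    - by move=> ? ? ?; apply: large_low.
    - move=> s s' vs sv; apply: large_split => // [t _|n ns S'n].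
        by rewrite bS addnn -mul2n leq_mul2r /W addn1 mulnS orbC.
      have vn : (v k < n <= v k.+1)%N.
        by case/andP: ns => sn ns'; rewrite (leq_ltn_trans vs sn) (leq_trans ns' sv).
      by case: (pselect (good m e1 (eta x) (nu n q))) => gn; [left|right].
  (* If no lower index is bad, the lower stable piece and the good part of the upper one both have
     hull elements of almost minimal energy. These are close off a set of measure below [eta x],
     which [not_both_good] excludes. *)
  - right; apply: contrapT => noN.
    have goodN n : (x < n <= y1)%N -> good m e1 (eta x) (nu n q).
      by move=> xn; apply: contrapT => ng; apply: noN; exists n.
    have [||h' hh' eh'] := low G.
    + by move=> s [].
    + apply: (chain_sub (@large_le _ _ _) _ _ _ _ lgG) => //; last first.
        exact: leq_trans (leq_trans xy1 (leq_trans y1y2' y2'y2)) y2vk.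
      by move=> ? ? ? _ /andP[_ ?] _; apply: large_low.
    pose N s := S' s /\ (u i < s <= u i.+1)%N.
    have [||hN hhN ehN] := low N.
    + by move=> s [].
    + apply: (chain_sub Lle _ _ _ _ (uP _ iV)) => //; last first.
        exact: leq_trans uiy1 (leq_trans y1y2' (leq_trans y2'y2 y2L)).
      move=> s s' t us /andP[_ ss] tu; apply: large_sub => //.
        by move=> r _; rewrite bS leq_pmull.
      move=> r /andP[sr rt] S'r; split=> //.
      by rewrite (leq_ltn_trans us sr) (leq_trans rt tu).
    apply: (@not_both_good N G hN h' q (eta x)) => //.
    + by move=> n [_ /andP[_ ni]]; apply: leq_ltn_trans (leq_trans ni uiy1) y1q.
    + move=> n [_ /andP[kn nk] _]; rewrite (leq_trans nk vkL) andbT.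
      exact: leq_ltn_trans (leq_trans qy2 y2vk) kn.
    + by move=> n n' [_ ?] [_ ?]; apply: sti.
    + by move=> n n' [_ ? _] [_ ? _]; apply: stk.
    + apply: le_lt_trans (energy_gap m0 hN h' K0 d0) _.
      (* The midpoint stays in the hull of [S'], so its energy is at least [l%:R * th], while both
         ends have less than [l.+1%:R * th]; the gap is below [th]. *)
      have mid : hull f S' (fun t => (hN t + h' t) / 2).
        by apply: hull_mid; [apply: hull_sub hhN => ? []|apply: hull_sub hh' => ? []].
      have := en' _ mid; have := hull_norm1 m0 fB hhN; have := hull_norm1 m0 fB hh'.
      set E3 := energy m K (fun t => _); set E1 := energy m K hN in ehN *.
      set E2 := energy m K h' in eh' *; set N1 := norm1 m hN; set N2 := norm1 m h'.
      move=> n2 n1 e3.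
      apply: (@le_lt_trans _ _ ((B + B) / K + 4 / d ^+ 2 * th)).
        apply: lerD; first by rewrite ler_pM2r ?invr_gt0 // lerD.
        rewrite ler_wpM2l ?divr_ge0 ?sqr_ge0 //.
        by move: ehN eh' e3; rewrite -natr1; lra.
      rewrite /K /th [ltLHS](_ : _ = eta x / 2); last first.
        by field; rewrite !gt_eqF.
      by rewrite ltr_pdivrMr // mulr_natr mulr2n ltrDl.
    + move=> n [_ /andP[un ni]]; apply: goodN.
      by rewrite (leq_ltn_trans xui un) (leq_trans ni uiy1).
    + by move=> n [].
  - left; exists k => //; case: (c) c0 lgB => [//|c' _] [y lgy /(chain_le (@large_le _ _ _)) yv].
    apply: (large_sub _ _ _ _ _ lgy) => //.
      by move=> s _ [S's /andP[ks sk] ngs]; split=> //; rewrite ks (leq_trans sk vkL).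
    exact: leq_trans yv vkL.
case: (pselect (exists q k, [/\ (y1 < q <= y2')%N, (k <= V1)%N & Mcase q k])).
  case=> q [k [qy kV lgM]]; have [y2vk vkL] := vB _ kV.
  exists (v k), (fun s => [/\ S' s, (v k < s <= L)%N & ~ good m e1 (eta x) (nu s q)]), q.
  split=> //; [|by move=> s [/SS' ? ? _]|by right=> s []].
  case/andP: qy => y1q qy2'; rewrite (leq_ltn_trans xy1 y1q).
  exact: leq_trans qy2' (leq_trans y2'y2 y2vk).
move=> noM.
(* Now every [q] of [S'] in the middle interval has a bad index [i <= y1]. Colouring [q] by [i]
   needs at most [y1.+1] colours, paid for by the factor [t.+1] of [b]. *)
pose C i q := [/\ S' q, (y1 < q <= y2')%N, (x < i <= y1)%N & ~ good m e1 (eta x) (nu i q)].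
have [||i iy1 lgC] := @large_color (b l) h S' C y1 j.+1 y1 y2' hh _ _ lgQ.
- move=> t y1t; apply: leq_trans (b_h l t); rewrite leq_mul2r ltnS y1t orbT //.
- move=> q qy S'q; case: (dich q qy) => [[k kV Mq]|[n xn ng]].
    by exfalso; apply: noM; exists q, k.
  by exists n; [case/andP: xn|split].
have [q [_ _ [_ _ xi _]]] := large_ex h0 lgC.
exists y1, (C i), i; split=> //.
- move=> s [/SS' Ss /andP[y1s sy] _ _]; split=> //.
  by rewrite y1s (leq_trans sy (leq_trans y2'y2 y2L)).
- by apply: large_sub lgC => //; apply: leq_trans y2'y2 y2L.
- by left=> s [].
Qed.

(** * Accumulation of humps *)

(** The list [l] serves all [q] in [I] at once, while the set [A] may depend on [q]. Goodness of the
    listed weights at the scale [eta x] allows the next hump to alter [A]. *)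
Definition humped (w : nat -> nat -> T -> R) x I l : Prop :=
  forall q, I q ->
    (forall n, n \in l -> (n <= x)%N /\ good m k1 (eta x) (w n q)) /\
    exists A, sorted (jump (w^~ q) (e1 / 2 - 2 * k1 * (size l)%:R) A) l.

Lemma humped_sub w x y I I' l : (x <= y)%N -> (forall q, I' q -> I q) ->
  humped w x I l -> humped w y I' l.
Proof.
move=> xy II hI q /II /hI[gd sl]; split=> // n /gd[nx gn]; split; first lia.
by apply: good_weaken gn; apply: eta_mono.
Qed.

(** Badness of [w p q] at the scale [eta x] supplies the hump, on which the listed weights are
    small. At the cost of one level, [equicontinuous_subset] for [w p] then thins out the indices so
    that [p] too becomes good at a later scale. *)
Lemma humped_cons w x p a I I1 l h j :
  (forall n, (n <= L)%N -> fluct_bound (w n) V2 c2 L) ->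
  (forall s n q A, (n <= s)%N -> (q <= s)%N -> wsum m A < eta s ->
     `|wsum (w n q) A| <= k2) ->
  {homo h : a b / (a <= b)%N} -> (forall t, (0 < h t)%N) -> (x < p <= a)%N ->
  (forall s, I1 s -> I s /\ (a < s <= L)%N) -> humped w x I l ->
  (forall q, I1 q -> ~ good m e1 (eta x) (w p q)) ->
  large (fun t => (2 * V2.+2).+1 * 2 ^ V2.+2 * h t)%N I1 j.+1 a L ->
  exists y I2, [/\ (a <= y)%N, forall s, I2 s -> I1 s /\ (y < s <= L)%N,
    large h I2 j y L & humped w y I2 (p :: l)].
Proof.
move=> fl small hh h0 /andP[xp pa] I1I hI bad lg.
have pL : (p <= L)%N by apply: leq_trans pa (large_le lg).
have [||y [I2 [ay I2I1 lg2 gd]]] :=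
    equicontinuous_subset m0 (fl p pL) k20 c2k2 _ eta_mono hh h0 (leqnn L) _ lg.
- by move=> s q A as_ qs; apply: small => //; lia.
- by move=> s /I1I[].
exists y, I2; split=> // q I2q; have [I1q yq] := I2I1 _ I2q; have [Iq aq] := I1I _ I1q.
have [gdl [A sA]] := hI _ Iq.
split=> [n|].
  rewrite inE => /orP[/eqP ->|/gdl[nx gn]]; first by split; [lia|apply: gd].
  by split; [lia|apply: good_weaken gn; apply: eta_mono; lia].
have [A' [mA' eA']] := not_good (bad _ I1q).
have sz : (size (p :: l))%:R = (size l)%:R + 1 :> R by rewrite natr1.
apply: (hump_step k10 _ _ sA _ _ eA'); rewrite ?sz.
- by lra.
- by have := mulr_ge0 k10 (ler0n R (size l)); move: k10; rewrite -mulrA mulrDr mulr1; set s := k1 * _; lra.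
- by apply/allP => n /gdl[nx _]; apply: leq_ltn_trans nx xp.
- move=> n /gdl[nx gn] A'' sub; apply/ltW/gn.
  by apply: le_lt_trans mA'; apply: wsum_sub.
Qed.

(** By [c1k1], the jumps left after at most [2 * V1 + 3] humps still have size [c1]. *)
Lemma humped_size w x I l q : (q <= L)%N -> (x <= L)%N -> I q ->
  fluct_bound (w^~ q) V1 c1 L -> (size l <= 2 * V1 + 3)%N -> humped w x I l ->
  (size l <= V1.+1)%N.
Proof.
move=> qL xL Iq fb sl /(_ _ Iq)[gd [A sA]].
have fb' : fluct_bound (w^~ q) V1 (e1 / 2 - 2 * k1 * (size l)%:R) L.
  move=> A' x' y' h1 h2 h3; have [i iV lt] := fb A' x' y' h1 h2 h3.
  exists i => //; apply: lt_le_trans lt _; apply: le_trans c1k1 _.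
  by rewrite lerD2l lerN2 ler_wpM2l ?mulr_ge0 // ler_nat.
by apply: (jumps_bounded fb' sA); apply/allP => n /gd[nx _]; lia.
Qed.

(** The cost of one hump in the base function: [W ^ steps t] for the energy descent, [t.+1] for the
    colouring, the rest for [equicontinuous_subset]. *)
Definition growth t := (W ^ steps t * (t.+1 * ((2 * V2.+2).+1 * 2 ^ V2.+2)))%N.

Lemma growth_homo k : {homo (fun t => growth t ^ k)%N : a b / (a <= b)%N}.
Proof.
move=> a b ab; case: k => [|k]; first by rewrite !expn0.
rewrite leq_exp2r // leq_mul // ?leq_mul // leq_pexp2l ?steps_mono //.
Qed.

Lemma growth_gt0 k t : (0 < growth t ^ k)%N.
Proof.
rewrite expn_gt0; apply/orP; left; rewrite /growth muln_gt0 expn_gt0 /W addn1 /=.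
by rewrite muln_gt0 muln_gt0 expn_gt0.
Qed.

(** Each hump joins [ns] or [qs] and costs one factor [growth] and two levels, one in [new_hump] and
    one in [humped_cons]. After [2 * V1 + 3] humps one list has more than [V1.+1] entries, against
    [humped_size]. *)
Lemma separated_contradiction x :
  ~ large (fun t => growth t ^ (2 * V1 + 3))%N (fun s => x < s <= L)%N
    (2 * (2 * V1 + 3)) x L.
Proof.
suff claim k x0 I ns qs : (size ns + size qs + k = 2 * V1 + 3)%N ->
    (forall s, I s -> (x0 < s <= L)%N) -> humped nu x0 I ns ->
    humped (fun q n => nu n q) x0 I qs ->
    ~ large (fun t => growth t ^ k)%N I (2 * k) x0 L.
  by apply: (claim _ _ _ [::] [::]) => // s _; split=> //; exists set0.
elim: k x0 I ns qs => [|k IH] x0 I ns qs sz Ix hn hq lg.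
  have [s [xs sL Is]] := large_ex (growth_gt0 0) lg.
  have x0L : (x0 <= L)%N by lia.
  have := humped_size sL x0L Is (fluct1 sL) _ hn.
  have := humped_size sL x0L Is (fluct1' sL) _ hq.
  lia.
pose h t := ((2 * V2.+2).+1 * 2 ^ V2.+2 * growth t ^ k)%N.
have hh : {homo h : a b / (a <= b)%N}.
  by move=> a b ab; rewrite leq_mul2l growth_homo ?orbT.
have h0 t : (0 < h t)%N by rewrite /h muln_gt0 growth_gt0 muln_gt0 expn_gt0.
have [|a [I1 [p [xp I1I lg1 alt]]]] := @new_hump I (2 * k) x0 h hh h0 Ix.
  have -> : (2 * k).+2 = (2 * k.+1)%N by lia.
  apply: large_sub lg => //.
    by move=> u v uv; rewrite leq_mul2l leq_mul ?orbT ?ltnS ?hh.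
  move=> t x0t; rewrite expnS /h; move: (growth t ^ k)%N => G.
  by rewrite /growth -!mulnA leq_mul // leq_pexp2l ?steps_mono // /W addn1.
have next y I2 : (a <= y)%N -> (forall s, I2 s -> I1 s /\ (y < s <= L)%N) ->
    (x0 <= y)%N /\ (forall s, I2 s -> I s) /\ (forall s, I2 s -> (y < s <= L)%N).
  by move=> ay I2I1; split; [lia|split=> s /I2I1[/I1I[]]].
case: alt => bad.
- have [y [I2 [ay I2I1 lg2 hn2]]] :=
    humped_cons fluct2' eta_small (@growth_homo k) (growth_gt0 k) xp I1I hn bad lg1.
  have [xy [I2I I2y]] := next _ _ ay I2I1.
  by apply: (IH y I2 (p :: ns) qs) lg2 => //; [rewrite /=; lia|apply: humped_sub hq].
- have [|y [I2 [ay I2I1 lg2 hn2]]] :=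
    humped_cons (w := fun q n => nu n q) fluct2 _ (@growth_homo k) (growth_gt0 k) xp I1I hq bad lg1.
    by move=> s n q A ns_ qs_; apply: eta_small.
  have [xy [I2I I2y]] := next _ _ ay I2I1.
  by apply: (IH y I2 ns (p :: qs)) lg2 => //; [rewrite /=; lia|apply: humped_sub hn].
Qed.
End Core.

(** * Products on a partition *)

Section Refinement.
Context {d : Order.disp_t} {S : ctbDistrLatticeType d}.
Implicit Types (s t : S) (A : {fset S}).

Lemma refined_trans A1 A2 A3 : refined_by A1 A2 -> refined_by A2 A3 -> refined_by A1 A3.
Proof.
move=> [j12 s12] [j23 s23]; split; first by rewrite j12.
by move=> t /s23[u /s12[v vA uv] tu]; exists v => //; apply: le_trans uv.
Qed.

Lemma partition1 s : is_partition [fset s]%fset.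
Proof. by move=> a b /fset1P -> /fset1P ->; rewrite eqxx. Qed.

Lemma le_join_fset A s : s \in A -> (s <= \join_(t <- A) t)%O.
Proof. by move=> sA; apply: joins_sup_seq. Qed.

(** The nonzero meets. Without [\bot], disjoint parts are distinct, so that sums over unions of
    partitions split. *)
Lemma common_refinement A1 A2 : is_partition A1 -> is_partition A2 ->
  (\join_(s <- A1) s)%O = (\join_(s <- A2) s)%O ->
  exists A, [/\ is_partition A, refined_by A1 A, refined_by A2 A & \bot%O \notin A].
Proof.
move=> p1 p2 j12.
pose A := ([fset (a `&` b)%O | a in A1, b in A2] `\ \bot%O)%fset.
have AP t : t \in A -> exists a b, [/\ a \in A1, b \in A2 & t = (a `&` b)%O].
  rewrite in_fsetD1 => /andP[_ /imfset2P[a aA [b bA ->]]]; by exists a, b.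
have jA : (\join_(s <- A) s)%O = (\join_(s <- A1) s)%O.
  apply/le_anti/andP; split.
    apply/joinsP_seq => t /AP[a [b [aA bA ->]]] _.
    by apply: le_trans (leIl _ _) (le_join_fset aA).
  apply/joinsP_seq => a aA _.
  have -> : a = (\join_(b <- A2) (a `&` b))%O.
    rewrite -(big_morph (fun x => a `&` x)%O (meetUr a) (meetx0 a)) -j12.
    by apply/esym/meet_idPl; apply: le_join_fset.
  apply/joinsP_seq => b bA _.
  have [->|ab0] := eqVneq (a `&` b)%O \bot%O; first exact: le0x.
  apply: le_join_fset; rewrite in_fsetD1 ab0 /=.
  by apply/imfset2P; exists a => //; exists b.
exists A; split.
- move=> _ _ /AP[a [b [aA bA ->]]] /AP[a' [b' [aA' bA' ->]]] ne.
  have [aa|/(p1 _ _ aA aA') aa] := eqVneq a a'.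
    have [bb|/(p2 _ _ bA bA') bb] := eqVneq b b'.
      by rewrite aa bb eqxx in ne.
    by rewrite meetACA bb meetx0.
  by rewrite meetACA aa meet0x.
- split=> // t /AP[a [b [aA bA ->]]]; exists a => //; exact: leIl.
- split; first by rewrite -j12.
  by move=> t /AP[a [b [aA bA ->]]]; exists b => //; exact: leIr.
- by rewrite in_fsetD1 eqxx.
Qed.

Lemma common_refinement_seq (l : seq {fset S}) :
  (forall A, A \in l -> is_partition A /\ (\join_(s <- A) s)%O = \top%O) ->
  exists P, [/\ is_partition P, \bot%O \notin P, (\join_(s <- P) s)%O = \top%O &
    forall A, A \in l -> refined_by A P].
Proof.
elim: l => [_|A l IH Al].
  have p1 := @partition1 \top%O.
  have [P [pP [jP _] _ bP]] := common_refinement p1 p1 erefl.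
  by exists P; split=> //; rewrite -jP big_seq_fset1.
have [A' A'l|P [pP bP jP Pl]] := IH; first by apply: Al; rewrite inE A'l orbT.
have [pA jA] := Al A (mem_head _ _).
have [|P' [pP' rA rP bP']] := common_refinement pA pP; first by rewrite jA jP.
exists P'; split=> //; first by rewrite -rP.1.
move=> A'; rewrite inE => /orP[/eqP -> //|/Pl rA']; exact: refined_trans rA' rP.
Qed.
End Refinement.

Section Products.
Context {R : realType} {d : Order.disp_t} {S : ctbDistrLatticeType d}.
Implicit Types (mu rho lam nu : S -> R) (s t : S) (A P : {fset S}).

Lemma lim_product_approx mu rho lam s e : product_defined mu rho lam -> 0 < e ->
  exists A0, [/\ is_partition A0, refined_by [fset s]%fset A0 &
    forall A, is_partition A -> refined_by A0 A ->
      `|lim_product mu rho lam s - sum_on (star_product mu rho lam) A| < e].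
Proof.
move=> [_ /(_ s) cv] e0.
have : nbhs (lim_product mu rho lam s) (ball (lim_product mu rho lam s) e).
  exact: nbhsx_ballx.
move=> /cv[A0 [pA0 rA0] sub]; exists A0; split=> // A pA rA.
exact: (sub A (conj pA rA)).
Qed.

(** Refine only the parts satisfying [p], until their sum is within [e] of the limit at their join,
    and keep the other parts. Both this partition and [P] are within [e] of the limit at [\top], so
    the sums over the selected parts differ by less than [2 * e]. *)
Lemma lim_product_union mu rho lam P (p : pred S) e :
  product_defined mu rho lam -> 0 < e -> rho \bot%O = 0 ->
  is_partition P -> \bot%O \notin P ->
  (forall A, is_partition A -> refined_by P A ->
    `|lim_product mu rho lam \top%O - sum_on (star_product mu rho lam) A| < e) ->
  `|lim_product mu rho lam (\join_(s <- P | p s) s)%O -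
    \sum_(s <- P | p s) star_product mu rho lam s| < 3 * e.
Proof.
move=> pd e0 rho0 pP bP approx.
set star := star_product mu rho lam in approx *.
set u := (\join_(s <- P | p s) s)%O.
pose G := [fset x in P | p x]%fset; pose C := [fset x in P | ~~ p x]%fset.
have GP x : x \in G -> x \in P by rewrite !inE => /andP[].
have CP x : x \in C -> x \in P by rewrite !inE => /andP[].
have jG : (\join_(s <- G) s)%O = u by rewrite /G big_fset.
have [A1 [pA1 rA1 lA1]] := lim_product_approx u pd e0.
have pG : is_partition G by move=> a b /GP aP /GP bP'; apply: pP.
have [|A' [pA' r1 rG bA']] := common_refinement pA1 pG.
  by rewrite jG -rA1.1 big_seq_fset1.
have disj a c : a \in A' -> c \in C -> (a `&` c)%O = \bot%O.
  move=> /rG.2[b bG ab] cC.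
  have bc : (b `&` c)%O = \bot%O.
    apply: pP; [exact: GP|exact: CP|].
    by apply: contraTneq bG => ->; move: cC; rewrite !inE => /andP[-> /negbTE ->].
  by apply/le_anti; rewrite le0x andbT -bc leI2.
have nA'C a : a \in A' -> a \in C -> False.
  move=> aA' aC; have := disj a a aA' aC; rewrite meetxx => a0.
  by move: bA'; rewrite -a0 aA'.
pose A := (A' `|` C)%fset.
have pA : is_partition A.
  move=> a b; rewrite !in_fsetU => /orP[aA|aC] /orP[bA|bC] ab.
  - exact: pA'.
  - exact: disj.
  - by rewrite meetC; apply: disj.
  - by apply: pP => //; apply: CP.
have sumA (F : S -> R) : \sum_(s <- A) F s = \sum_(s <- A') F s + \sum_(s <- C) F s.
  rewrite (big_fsetID _ (mem A')) /=; congr (_ + _); apply: eq_fbigl => x;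
    apply/imfsetP/idP => [[y /andP[/=]]|xA].
  - by move=> _ yA' ->.
  - by exists x => //=; apply/andP; split=> //=; rewrite in_fsetU xA.
  - by rewrite in_fsetU => /orP[yA /negP[]//|yC _ ->].
  - exists x => //=; apply/andP; split=> /=; first by rewrite in_fsetU xA orbT.
    by apply/negP => xA'; apply: (nA'C x).
have joinA : (\join_(s <- A) s)%O = (\join_(s <- P) s)%O.
  have jC : (\join_(s <- P) s)%O = (u `|` \join_(s <- C) s)%O.
    by rewrite (bigID p) /= /C big_fset.
  rewrite jC -jG rG.1; apply/le_anti/andP; split.
    apply/joinsP_seq => x; rewrite in_fsetU => /orP[] xA _.
      by apply: lexUl; apply: le_join_fset.
    by apply: lexUr; apply: le_join_fset.
  rewrite leUx; apply/andP; split; apply/joinsP_seq => x xA _; apply: le_join_fset.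
    by rewrite in_fsetU xA.
  by rewrite in_fsetU xA orbT.
have rPA : refined_by P A.
  split=> // x; rewrite in_fsetU => /orP[/rG.2[b /GP bP' xb]|/CP xP]; first by exists b.
  by exists x.
have rPP : refined_by P P by split=> // x xP; exists x.
have h1 := approx A pA rPA; have h2 := approx P pP rPP; have h3 := lA1 A' pA' r1.
have eG : \sum_(s <- P | p s) star s + \sum_(s <- C) star s = \sum_(s <- P) star s.
  by rewrite [RHS](bigID p) /= /C big_fset.
move: h1 h2 h3; rewrite /sum_on sumA -eG -/star !ltr_norml.
move=> /andP[? ?] /andP[? ?] /andP[? ?]; apply/andP; split; lra.
Qed.
End Products.

(** * Density bounds and fluctuations over consecutive intervals *)

Section Bounds.
Context {R : realType} {d : Order.disp_t} {S : ctbDistrLatticeType d}.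
Implicit Types (mu nu : S -> R) (s : S) (A : {fset S}).

Lemma abs_sum_on_le nu (B : R) A : (L1_norm nu <= B%:E)%E -> is_partition A ->
  abs_sum_on nu A <= B.
Proof.
move=> nuB pA; rewrite -lee_fin; apply: le_trans nuB.
by apply: ereal_sup_ubound; exists A.
Qed.

(** If [mu s] is small, the modulus is used at a scale [E] slightly below [1 / (2 ^ n * mu s)];
    otherwise the L^1 bound is enough. *)
Lemma density_bound mu nu omega (B n : nat) s : (0 < B)%N -> 0 <= mu s ->
  (mu s = 0 -> nu s = 0) -> (L1_norm nu <= (B%:R)%:E)%E ->
  modulus_of_continuity mu nu omega ->
  (forall E, (0 < E)%N -> (omega E <= E * 2 ^ n)%N) ->
  `|nu s| <= (B * 2 ^ (n + 2))%:R * mu s.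
Proof.
move=> B0 mu0 null nuB mod om.
have [/null ->|mus] := eqVneq (mu s) 0; first by rewrite normr0 mulr_ge0.
have {mu0 mus}x0 : 0 < mu s by rewrite lt_def mus.
have p0 : 0 < (2 ^ n)%:R :> R by rewrite ltr0n expn_gt0.
have B1 : 1 <= B%:R :> R by rewrite ler1n.
have nusB : `|nu s| <= B%:R.
  by have := abs_sum_on_le nuB (@partition1 _ S s); rewrite /abs_sum_on big_seq_fset1.
rewrite expnD natrM natrM.
set p : R := (2 ^ n)%:R in p0 *; set x := mu s in x0 *.
have -> : (2 ^ 2)%:R = 4 :> R by [].
case: (lerP 1 (4 * p * x)) => px.
  by apply: le_trans nusB _; nra.
pose y := (p * x)^-1.
have px0 : 0 < p * x by apply: mulr_gt0.
have y4 : 4 < y by rewrite -[ltLHS]invrK ltf_pV2 ?posrE //; lra.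
have /andP[ky yk] := truncn_itv (ltW (lt_trans (ltr0Sn R 3) y4)).
set k := Num.truncn y in ky yk.
have k4 : (4 <= k)%N by have := lt_trans y4 yk; rewrite ltr_nat ltnS.
(* One below the truncation, [E < y] is strict, as the modulus requires, and [E >= 3] gives
   [y < E + 2 <= 4 * E]. *)
have [E kE E3] : exists2 E, k = E.+1 & (3 <= E)%N by case: (k) k4 => [//|E]; exists E.
have E0 : (0 < E)%N := leq_trans (ltn0Sn 2) E3.
have E0' : 0 < E%:R :> R by rewrite ltr0n.
have Ek : k%:R = E%:R + 1 :> R by rewrite kE natr1.
have [w0 wP] := mod _ E0.
have : abs_sum_on nu [fset s]%fset < E%:R^-1.
  apply: wP; first exact: partition1.
  rewrite /sum_on big_seq_fset1 -/x.
  apply: (@lt_le_trans _ _ (E * 2 ^ n)%:R^-1); last first.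
    by rewrite lef_pV2 ?posrE ?ltr0n ?muln_gt0 ?E0 ?expn_gt0 // ler_nat om.
  rewrite natrM -/p -[ltLHS]invrK ltf_pV2 ?posrE ?invr_gt0 ?mulr_gt0 //.
  have -> : x^-1 = y * p by rewrite /y; field; rewrite !gt_eqF.
  by rewrite ltr_pM2r //; lra.
rewrite /abs_sum_on big_seq_fset1 => /ltW /le_trans; apply.
have e2 : y < 4 * E%:R.
  have : 3 <= E%:R :> R by rewrite ler_nat.
  by move: yk; rewrite -natr1; lra.
apply: (@le_trans _ _ (4 * (p * x))); last by nra.
rewrite -[leRHS]invrK lef_pV2 ?posrE ?invr_gt0 ?mulr_gt0 //.
rewrite invfM -/y; lra.
Qed.

(** The monotone function [m] sends [t] at least to [y i] for the first [x i] at or above [t], and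
    its [k]-th iterate from [x 0] is at most [x k]. The stable interval therefore contains [x i] and
    [y i] for some [i]. *)
Lemma fluctuations_pieces (nu_ : nat -> S -> R) V E s (x y : nat -> nat) :
  bounded_fluctuations nu_ V -> (0 < E)%N ->
  (forall i, (i <= V E)%N -> (x i <= y i)%N) ->
  (forall i, (i < V E)%N -> (y i <= x i.+1)%N) ->
  exists2 i, (i <= V E)%N & `|nu_ (x i) s - nu_ (y i) s| < E%:R^-1.
Proof.
move=> bf E0 xy yx.
(* If no earlier [x i] reaches [t], [find] returns the length [V E], which is the last admissible
   index. *)
pose fi t := find (fun i => t <= x i)%N (iota 0 (V E)).
have fiV t : (fi t <= V E)%N by rewrite -[X in (_ <= X)%N](size_iota 0) find_size.
have fi_le k : (k <= V E)%N -> (fi (x k) <= k)%N.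
  rewrite leq_eqVlt => /orP[/eqP ->|kV]; first exact: fiV.
  by rewrite leqNgt; apply/negP => /(before_find 0%N); rewrite nth_iota // add0n leqnn.
have fiP t : (t <= x (V E))%N -> (t <= x (fi t))%N.
  move=> tV; have := fiV t; rewrite leq_eqVlt => /orP[/eqP ->//|ltV].
  have hs : has (fun i => t <= x i)%N (iota 0 (V E)) by rewrite has_find size_iota.
  by have := nth_find 0%N hs; rewrite -/(fi t) nth_iota.
have ymono := @homo_upto y (V E) (fun i iV => leq_trans (yx _ iV) (xy _ iV)).
pose m t := maxn t (y (fi t)).
have m_homo : {homo m : i j / (i <= j)%N}.
  move=> i j ij; rewrite /m geq_max leq_max ij /=; rewrite leq_max; apply/orP; right.
  by apply: ymono (fiV _); apply: sub_find => k /=; apply: leq_trans.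
have m_ge i : (i <= m i)%N by apply: leq_maxl.
have it k : (k <= V E)%N -> (iter k m (x 0%N) <= x k)%N.
  elim: k => [//|k IH] kV; rewrite iterS.
  apply: leq_trans (m_homo _ _ (IH (ltnW kV))) _.
  rewrite /m geq_max; apply/andP; split; first exact: leq_trans (xy _ (ltnW kV)) (yx _ kV).
  by apply: leq_trans (yx _ kV); apply: ymono (ltnW kV); apply/fi_le/ltnW.
have [t /andP[xt tV] st] := bf E E0 m m_homo m_ge (x 0%N) s.
have tx := fiP _ (leq_trans tV (it _ (leqnn _))).
exists (fi t) => //; apply: st.
  by rewrite tx leq_max (xy _ (fiV t)) orbT.
by rewrite (leq_trans tx (xy _ (fiV t))) leq_maxr.
Qed.
End Bounds.

(** * Large intervals from the hierarchy [w_fun] *)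

Lemma chain_iter L (w : nat -> nat) c x : (forall x, L x (w x)) -> chain L c x (iter c w x).
Proof.
move=> Lw; elim: c x => [|c IH] x; first exact: leqnn.
by rewrite iterSr; exists (w x).
Qed.

(** [w_fun] and [large] follow the same recursion: a step of level [j.+1] from [x] consists of
    [w_iterations a i B E x] steps of level [j]. *)
Lemma large_w_fun a i B E j x :
  large (w_iterations a i B E) (fun=> True) j x (w_fun a i B E j x).
Proof.
elim: j x => [|j IH] x; first by exists x.+1.
exact: chain_iter.
Qed.

Lemma le_iter_infl (w : nat -> nat) c x : (forall x, (x <= w x)%N) -> (w x <= iter c.+1 w x)%N.
Proof. by move=> ww; elim: c => [//|c IH]; rewrite iterS; apply: leq_trans IH (ww _). Qed.

(** * Choice of constants *)

Section Constants.
Variables (B E : nat).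
Hypotheses (B0 : (0 < B)%N) (E0 : (0 < E)%N).
Local Open Scope nat_scope.

(* [main_fluc] and [fine_fluc] are the fluctuation bounds at the scales [1 / (2E)],
   for the main humps, and [1 / fine_scale], for the equicontinuity of each of them;
   [hump_count] exceeds twice the number of humps that a scale [1 / (2E)] allows, and
   [(inv_eta s)^-1] is a measure below which the products of the first [s] functions
   are negligible.  The energies fit into [energy_steps] steps. *)
Definition main_fluc := 8 * B ^ 2 * (2 * E) ^ 2.
Definition hump_count := 2 * main_fluc + 3.
Definition fine_scale := 16 * E * hump_count.
Definition fine_fluc := 8 * B ^ 2 * fine_scale ^ 2.
Definition inv_eta s := 16 * E * hump_count * fine_fluc.+2 * (B * 2 ^ (s + 2)) ^ 2.
Definition energy_steps s := 256 * B ^ 4 * E ^ 2 * inv_eta s ^ 2 + 1.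

Lemma main_flucE : main_fluc = 32 * (B ^ 2 * E ^ 2).
Proof. by rewrite /main_fluc (expnMn 2 E); lia. Qed.

(** Every quantity is at most a power of [X], the product of the arguments of [a] in [w_iterations];
    the exponents are generous. *)
Lemma growth_bound t : 0 < t ->
  growth main_fluc fine_fluc energy_steps t ^ hump_count <= 2 ^ ((B * (E * 2 ^ (t + 5)) * (B * E)) ^ 60).
Proof.
move=> t0; set X := B * (E * 2 ^ (t + 5)) * (B * E).
have Bb : B <= B ^ 2 by rewrite expnS expn1 leq_pmulr.
have Ee : E <= E ^ 2 by rewrite expnS expn1 leq_pmulr.
have XE : X = B ^ 2 * E ^ 2 * 2 ^ (t + 5) by rewrite /X !expnS !expn0; nia.
have p5 : 2 ^ (t + 5) = 32 * 2 ^ t by rewrite expnD mulnC.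
have p2 : 2 ^ (t + 2) = 4 * 2 ^ t by rewrite expnD mulnC.
have T2 : 2 <= 2 ^ t by rewrite -[X in X <= _]expn1 leq_exp2l.
have tT : t < 2 ^ t by apply: ltn_expl.
have [[X64 X1 V1X B2X] [E2X EX tX BTX]] : [/\ 64 <= X, 1 < X, main_fluc <= X & 8 * B ^ 2 <= X] /\
    [/\ 16 * E ^ 2 <= X, 16 * E <= X, t <= X & B * 2 ^ (t + 2) <= X].
  have : 0 < B ^ 2 by lia.
  have : 0 < E ^ 2 by lia.
  rewrite main_flucE XE p5 p2; move: (B ^ 2) (E ^ 2) (2 ^ t) Bb Ee T2 tT => b e T.
  move=> Bb Ee T2 tT e0 b0.
  have be0 : 0 < b * e by rewrite muln_gt0 b0.
  have bbe : b <= b * e by rewrite leq_pmulr.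
  have ebe : e <= b * e by rewrite leq_pmull.
  have : 2 * (b * e) <= b * e * T by rewrite mulnC leq_mul2l T2 orbT.
  have : B * T <= b * e * T by rewrite leq_mul2r; apply/orP; right; lia.
  have : T <= b * e * T by rewrite leq_pmull.
  have -> : b * e * (32 * T) = 32 * (b * e * T) by lia.
  have -> : B * (4 * T) = 4 * (B * T) by lia.
  by move: (b * e) (b * e * T) (B * T) bbe ebe be0 => be beT BT *; split; split; lia.
(* [mX], [eX] and [aX] track exponents through products, powers and sums; a sum costs one extra
   power because [X > 1]. *)
have pw a b : a <= b -> X ^ a <= X ^ b by rewrite leq_exp2l.
have mX k c e a b : a <= X ^ c -> b <= X ^ e -> c + e <= k -> a * b <= X ^ k.
  by move=> ac be ck; apply: leq_trans (pw _ _ ck); rewrite expnD leq_mul.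
have eX k c n a : a <= X ^ c -> c * n <= k -> 0 < n -> a ^ n <= X ^ k.
  by move=> ac ck n0; apply: leq_trans (pw _ _ ck); rewrite expnM leq_exp2r.
have aX k c e a b : a <= X ^ c -> b <= X ^ e -> c < k -> e < k -> a + b <= X ^ k.
  case: k => [//|k] ac be; rewrite !ltnS => ck ek.
  have := leq_trans ac (pw _ _ ck); have := leq_trans be (pw _ _ ek).
  rewrite expnS => h1 h2; apply: leq_trans (leq_add h2 h1) _.
  by rewrite addnn -mul2n leq_mul2r X1 orbT.
have cX k : k <= 64 -> k <= X ^ 1 by rewrite expn1 => /leq_trans; apply.
have xX a : a <= X -> a <= X ^ 1 by rewrite expn1.
have rX : hump_count <= X ^ 3 by apply: (aX 3 2 1) => //; [apply: (mX 2 1 1); auto|auto].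
have WX : 3 * main_fluc.+1 + 1 <= X ^ 4.
  apply: (aX 4 3 1); auto; apply: (mX 3 1 2); auto.
  by rewrite -addn1; apply: (aX 2 1 1); auto.
have E2X' : fine_scale <= X ^ 4 by apply: (mX 4 1 3); auto.
have V2X : fine_fluc <= X ^ 9 by apply: (mX 9 1 8); auto; apply: (eX 8 4 2).
have V2X' : fine_fluc.+2 <= X ^ 10 by rewrite -addn2; apply: (aX 10 9 1); auto.
have YX : inv_eta t <= X ^ 16.
  apply: (mX 16 14 2); [|apply: (eX 2 1 2)|]; auto.
  by apply: (mX 14 4 10); auto; apply: (mX 4 1 3); auto.
have TX : energy_steps t <= X ^ 37.
  apply: (aX 37 36 1); auto; apply: (mX 36 4 32); [|exact: (eX 32 16 2)|] => //.
  have eq256 : (8 * B ^ 2) ^ 2 * (4 * E ^ 2) = 256 * B ^ 4 * E ^ 2.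
    by rewrite expnMn -expnM mulnACA mulnA.
  by rewrite -eq256; apply: (mX 4 2 1); [apply: (eX 2 1 2); auto|apply/xX/(leq_trans _ E2X); rewrite leq_mul2r orbT|].
set W := 3 * main_fluc.+1 + 1 in WX; set q := fine_fluc.+2 in V2X'.
have gb : growth main_fluc fine_fluc energy_steps t <= 2 ^ (W * energy_steps t + (t + ((2 * q).+1 + q))).
  rewrite /growth -/W -/q (expnD 2 (W * _)) (expnD 2 t) (expnD 2 (2 * q).+1).
  apply: leq_mul; last first.
    by apply: leq_mul; [apply: ltn_expl|apply: leq_mul => //; apply/ltnW/ltn_expl].
  rewrite expnM; case: (energy_steps t) => [|k]; first by rewrite !expn0.
  by rewrite leq_exp2r //; apply/ltnW/ltn_expl.
apply: leq_trans (_ : (2 ^ (W * energy_steps t + (t + ((2 * q).+1 + q)))) ^ hump_count <= _).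
  by rewrite leq_exp2r // /hump_count addn3.
rewrite -expnM leq_exp2l //.
apply: (mX 60 45 3); auto; apply: (aX 45 41 40); auto; first by apply: (mX 41 4 37).
apply: (aX 40 1 20); auto; apply: (aX 20 15 10); auto.
by rewrite -addn1; apply: (aX 15 12 1); auto; apply: (mX 12 1 10); auto.
Qed.
End Constants.

Lemma energy_steps_homo B E : {homo energy_steps B E : s t / (s <= t)%N}.
Proof.
move=> s t st; rewrite /energy_steps leq_add2r leq_mul2l leq_exp2r //; apply/orP; right.
by rewrite leq_mul2l leq_exp2r // leq_mul2l leq_pexp2l ?orbT // leq_add2r.
Qed.

(** * Transfer to the parts of a fine partition *)

Section FiniteModel.
Context {R : realType} {d : Order.disp_t} {S : ctbDistrLatticeType d}.
Variables (mu : S -> R) (rho lam : nat -> S -> R) (B E : nat).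
Hypotheses (mu01 : forall s, 0 <= mu s <= 1)
  (rho_add : forall n, fin_additive (rho n))
  (prod : forall n p, product_defined mu (rho n) (lam p)) (B0 : (0 < B)%N)
  (fluct_lam : forall n, bounded_fluctuations (fun p => lim_product mu (rho n) (lam p))
               (fun E => 8 * B ^ 2 * E ^ 2)%N)
  (fluct_rho : forall p, bounded_fluctuations (fun n => lim_product mu (rho n) (lam p))
               (fun E => 8 * B ^ 2 * E ^ 2)%N)
  (mod_rho : forall n, exists2 omega, modulus_of_continuity mu (rho n) omega &
     forall E, (0 < E)%N -> (omega E <= E * 2 ^ n)%N)
  (mod_lam : forall p, exists2 omega, modulus_of_continuity mu (lam p) omega &
     forall E, (0 < E)%N -> (omega E <= E * 2 ^ p)%N)
  (rhoB : forall n, (L1_norm (rho n) <= (B%:R)%:E)%E)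
  (lamB : forall p, (L1_norm (lam p) <= (B%:R)%:E)%E)
  (E0 : (0 < E)%N).

Variables (L : nat) (P : {fset S}).
Hypotheses (partP : is_partition P) (botP : \bot%O \notin P)
  (joinP : (\join_(s <- P) s)%O = \top%O).

(** Replacing a product by its weight costs [3 * e], hence [6 * e = 1 / fine_scale] for a difference
    of two. *)
Let e : R := (6 * fine_scale B E)%:R^-1.

Hypothesis approx : forall n p, (n <= L)%N -> (p <= L)%N ->
  forall A, is_partition A -> refined_by P A ->
    `|lim_product mu (rho n) (lam p) \top%O - sum_on (star_product mu (rho n) (lam p)) A| < e.

Let m (t : P) : R := mu (val t).
Let f n (t : P) : R := rho n (val t) / mu (val t).
Let g n (t : P) : R := lam n (val t) / mu (val t).

Lemma fine_scale_gt0 : (0 < fine_scale B E)%N.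
Proof. by rewrite /fine_scale /hump_count addn3 muln_gt0 muln_gt0 E0. Qed.

Lemma e_gt0 : 0 < e.
Proof. by rewrite invr_gt0 ltr0n muln_gt0 fine_scale_gt0. Qed.

Lemma nu_star n q t : nu m f g n q t = star_product mu (rho n) (lam q) (val t).
Proof.
rewrite /nu /f /g /m /star_product.
have [->|m0] := eqVneq (mu (val t)) 0; first by rewrite invr0 !(mulr0, mul0r).
by field.
Qed.

Lemma norm1_le (h : nat -> S -> R) n : (forall n, (L1_norm (h n) <= (B%:R)%:E)%E) ->
  norm1 m (fun t => h n (val t) / mu (val t)) <= B%:R.
Proof.
move=> hB; apply: le_trans (abs_sum_on_le (hB n) partP).
rewrite /abs_sum_on big_seq_fsetE /norm1; apply: ler_sum => t _.
have /andP[mt _] := mu01 (val t); rewrite normrM normfV /m (ger0_norm mt).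
have [->|m0] := eqVneq (mu (val t)) 0; first by rewrite mul0r.
by rewrite mulrCA divff ?mulr1.
Qed.

Let join_of (A : {set P}) : S :=
  (\join_(s <- P | s \in [seq val t | t <- enum A]) s)%O.

Lemma lim_product_wsum n q (A : {set P}) : (n <= L)%N -> (q <= L)%N ->
  `|lim_product mu (rho n) (lam q) (join_of A) - wsum (nu m f g n q) A| < 3 * e.
Proof.
move=> nL qL.
have := lim_product_union (fun s => s \in [seq val t | t <- enum A]) (prod n q) e_gt0
  (rho_add n).1 partP botP (approx nL qL).
rewrite (_ : \sum_(s <- P | _) _ = wsum (nu m f g n q) A) //.
rewrite big_seq_fsetE; apply: eq_big => [t|t _]; last by rewrite nu_star.
by rewrite mem_map ?mem_enum //; apply: val_inj.
Qed.

Lemma join_of_setT : join_of setT = \top%O.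
Proof.
rewrite -joinP /join_of [LHS]big_seq_cond [RHS]big_seq; apply: eq_bigl => s.
rewrite andb_idr // => sP; apply/mapP; exists [` sP]%fset => //.
by rewrite mem_enum inE.
Qed.

Lemma lim_product_top n q : (n <= L)%N -> (q <= L)%N ->
  `|lim_product mu (rho n) (lam q) \top%O - wsum (nu m f g n q) setT| < 3 * e.
Proof. by rewrite -join_of_setT; apply: lim_product_wsum. Qed.

(** The fluctuation bound is applied to the element [join_of A]; the transfer adds at most [1 / D]
    to its [1 / D]. *)
Lemma model_fluct (F : nat -> S -> R) (w : nat -> P -> R) D :
  bounded_fluctuations F (fun E => 8 * B ^ 2 * E ^ 2)%N ->
  (forall n A, (n <= L)%N -> `|F n (join_of A) - wsum (w n) A| < 3 * e) ->
  (0 < D)%N -> (D <= fine_scale B E)%N ->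
  fluct_bound w (8 * B ^ 2 * D ^ 2) (2 / D%:R) L.
Proof.
move=> bf wF D0 DE A x y xy yx yL.
have [i iV lt] := fluctuations_pieces (join_of A) bf D0 xy yx.
exists i => //.
have ymono := @homo_upto y _ (fun i iV => leq_trans (yx _ iV) (xy _ iV)).
have yiL : (y i <= L)%N by apply: leq_trans yL; apply: ymono.
have h1 := wF _ A (leq_trans (xy _ iV) yiL); have h2 := wF _ A yiL.
have eD : 6 * e <= D%:R^-1.
  rewrite /e natrM invfM mulrA divff ?mul1r ?pnatr_eq0 //.
  by rewrite lef_pV2 ?posrE ?ltr0n ?fine_scale_gt0 // ler_nat.
move: lt h1 h2; rewrite !ltr_norml; move: eD; set D' := D%:R^-1.
move=> eD /andP[? ?] /andP[? ?] /andP[? ?]; apply/andP; split; lra.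
Qed.

Let k1 : R := (2 * E * hump_count B E)%:R^-1.
Let k2 : R := k1 / (8 * (fine_fluc B E).+2)%:R.
Let eta s : R := (inv_eta B E s)%:R^-1.

(** Both densities are at most [M = B * 2 ^ (s + 2)] by [density_bound], and [inv_eta] is chosen so
    that [M ^+ 2 * eta s = k2]. *)
Lemma model_small s n q A : (n <= s)%N -> (q <= s)%N -> wsum m A < eta s ->
  `|wsum (nu m f g n q) A| <= k2.
Proof.
move=> ns qs mA.
pose M : R := (B * 2 ^ (s + 2))%:R.
have M0 : 0 < M by rewrite ltr0n muln_gt0 B0 expn_gt0.
have bnd (h : nat -> S -> R) (k : nat) t : (k <= s)%N ->
    (forall n, exists2 omega, modulus_of_continuity mu (h n) omega &
     forall E, (0 < E)%N -> (omega E <= E * 2 ^ n)%N) ->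
    (forall p, (L1_norm (h p) <= (B%:R)%:E)%E) -> (mu t = 0 -> h k t = 0) ->
    `|h k t| <= M * mu t.
  move=> ks mod hB null; have [om mom ome] := mod k.
  have /andP[mut _] := mu01 t.
  apply: le_trans (density_bound B0 mut null (hB k) mom ome) _.
  by rewrite ler_wpM2r // ler_nat leq_mul2l leq_pexp2l ?orbT // leq_add2r.
apply: (@le_trans _ _ (M ^+ 2 * wsum m A)).
  rewrite /wsum mulr_sumr; apply: le_trans (ler_norm_sum _ _ _) _.
  apply: ler_sum => t _; rewrite nu_star /star_product /m.
  have /andP[mut _] := mu01 (val t).
  have [r0 l0] : (mu (val t) = 0 -> rho n (val t) = 0) /\ (mu (val t) = 0 -> lam q (val t) = 0).
    by split=> /((prod n q).1 _)[].
  have [m0|m0] := eqVneq (mu (val t)) 0; first by rewrite m0 invr0 !mulr0 normr0.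
  rewrite !normrM normfV (ger0_norm mut) ler_pdivrMr; last by rewrite lt_def m0.
  have -> : M ^+ 2 * mu (val t) * mu (val t) = (M * mu (val t)) * (M * mu (val t)) by ring.
  by apply: ler_pM; rewrite ?normr_ge0 // bnd.
apply: (@le_trans _ _ (M ^+ 2 * eta s)); first by rewrite ler_wpM2l ?ltW // exprn_gt0.
rewrite /eta /k2 /k1 /inv_eta [X in X^-1]natrM natrX -/M !natrM.
have r0 : (hump_count B E)%:R != 0 :> R by rewrite pnatr_eq0 /hump_count addn3.
have E0' : E%:R != 0 :> R by rewrite pnatr_eq0 -lt0n.
rewrite le_eqVlt; apply/orP; left; apply/eqP; field.
by rewrite r0 E0' -natrD !pnatr_eq0 -!lt0n B0 expn_gt0.
Qed.

Lemma model_pair : large (fun t => growth (main_fluc B E) (fine_fluc B E) (energy_steps B E) t ^ hump_count B E)%N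
    (fun s => (1 < s <= L)%N) (2 * hump_count B E) 1 L ->
  exists n q p : nat, [/\ (n < q)%N, (q < p)%N, (p <= L)%N &
    `|lim_product mu (rho n) (lam q) \top%O - lim_product mu (rho p) (lam q) \top%O|
       < 20%:R / E%:R].
Proof.
move=> lg; apply: contrapT => no.
have E0' : 0 < E%:R :> R by rewrite ltr0n.
have B0' : 0 < B%:R :> R by rewrite ltr0n.
have r0 : 0 < (hump_count B E)%:R :> R by rewrite ltr0n /hump_count addn3.
have DE : (2 * E <= fine_scale B E)%N.
  by rewrite /fine_scale /hump_count addn3 -mulnA (mulnC 16) -mulnA; nia.
have c1E : 2 / (2 * E)%:R = E%:R^-1 :> R by rewrite natrM; field; rewrite gt_eqF.
have Y0 s : (0 < inv_eta B E s)%N.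
  rewrite /inv_eta /hump_count addn3 muln_gt0; apply/andP; split.
    by rewrite muln_gt0 muln_gt0 muln_gt0 E0.
  by rewrite expn_gt0 muln_gt0 B0 expn_gt0.
have k10 : 0 < k1 by rewrite invr_gt0 natrM natrM !mulr_gt0.
have V1E : (8 * B ^ 2 * (2 * E) ^ 2)%N = main_fluc B E by [].
have V2E : (8 * B ^ 2 * fine_scale B E ^ 2)%N = fine_fluc B E by [].
(* With these constants the separation must exceed [11 / E]: [1 / E] from [d * B], [8 / E] from
   [2 * e1] and [2 / E] from [2 * c1]. The assumed [20 / E] loses at most [1 / E] in the
   transfer. *)
apply: (@separated_contradiction R _ m f g B%:R L _ _ _ _ (main_fluc B E) (fine_fluc B E)
  E%:R^-1 (2 / (fine_scale B E)%:R) (E%:R * B%:R)^-1 (4 / E%:R) k1 k2 eta (energy_steps B E)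
  _ _ _ _ _ _ _ _ _ _ _ _ _ _ _ 1%N lg).
- by move=> t; have /andP[] := mu01 (val t).
- by [].
- by move=> n; apply: norm1_le.
- by move=> n; apply: norm1_le.
- move=> q qL; rewrite -c1E -V1E.
  by apply: (model_fluct (fluct_rho q)) => // [n A nL|]; [apply: lim_product_wsum|rewrite muln_gt0].
- move=> q qL; rewrite -c1E -V1E.
  by apply: (model_fluct (fluct_lam q)) => // [n A nL|]; [apply: lim_product_wsum|rewrite muln_gt0].
- move=> q qL; rewrite -V2E.
  by apply: (model_fluct (fluct_rho q)) => // [n A nL|]; [apply: lim_product_wsum|apply: fine_scale_gt0].
- move=> q qL; rewrite -V2E.
  by apply: (model_fluct (fluct_lam q)) => // [n A nL|]; [apply: lim_product_wsum|apply: fine_scale_gt0].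
- by move=> s; rewrite invr_gt0 ltr0n.
- move=> a b ab; rewrite /eta lef_pV2 ?posrE ?ltr0n // ler_nat.
  by rewrite leq_mul2l leq_exp2r // leq_mul2l leq_pexp2l ?orbT // leq_add2r.
- exact: model_small.
- by rewrite invr_gt0 mulr_gt0.
- exact: ltW.
- by rewrite divr_ge0 // ltW.
- rewrite -/(hump_count B E) /k1 natrM natrM le_eqVlt; apply/orP; left; apply/eqP.
  by field; rewrite !gt_eqF.
- rewrite /k2 /k1 /fine_scale.
  have -> : (16 * E * hump_count B E)%:R = 16 * E%:R * (hump_count B E)%:R :> R by rewrite natrM natrM.
  have -> : (2 * E * hump_count B E)%:R = 2 * E%:R * (hump_count B E)%:R :> R by rewrite natrM natrM.
  rewrite (natrM _ 8).
  have v0 : 0 < (fine_fluc B E).+2%:R :> R by [].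
  move: ((fine_fluc B E).+2%:R) v0 => v v0.
  by rewrite le_eqVlt; apply/orP; left; apply/eqP; field; rewrite !gt_eqF.
- exact: energy_steps_homo.
- move=> s; rewrite /energy_steps /eta natrD.
  have Ys : 0 < (inv_eta B E s)%:R :> R by rewrite ltr0n.
  set Y : R := (inv_eta B E s)%:R in Ys *.
  have -> : (256 * B ^ 4 * E ^ 2 * inv_eta B E s ^ 2)%:R = 256 * B%:R ^+ 4 * E%:R ^+ 2 * Y ^+ 2 :> R.
    by rewrite /Y natrM natrM natrM !natrX.
  rewrite -subr_gt0.
  rewrite [ltRHS](_ : _ = (E%:R * B%:R * Y)^-1 ^+ 2).
    by rewrite exprn_gt0 // invr_gt0 !mulr_gt0.
  by field; rewrite !gt_eqF.
- move=> n q p nq qp pL; rewrite ltNge; apply/negP => le; apply: no; exists n, q, p; split=> //.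
  have qL : (q <= L)%N by lia.
  have nL : (n <= L)%N by lia.
  have h1 := lim_product_top nL qL; have h2 := lim_product_top pL qL.
  have e6 : 6 * e <= E%:R^-1.
    rewrite /e natrM invfM mulrA divff ?mul1r ?pnatr_eq0 //.
    by rewrite lef_pV2 ?posrE ?ltr0n ?fine_scale_gt0 // ler_nat; lia.
  have dB : (E%:R * B%:R)^-1 * B%:R = E%:R^-1 :> R by field; rewrite !gt_eqF.
  have iE : 0 < E%:R^-1 :> R by rewrite invr_gt0.
  move: h1 h2 le; rewrite dB !ltr_norml !ler_norml.
  move: e6 iE; set E' := E%:R^-1 => e6 iE.
  by move=> /andP[? ?] /andP[? ?] /andP[? ?]; apply/andP; split; lra.
Qed.
End FiniteModel.

Theorem theorem7p13 :
  exists (a : nat -> nat -> nat -> nat) (i : nat -> nat -> nat -> nat -> nat),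
  exponential3 a /\ double_exponential4 i /\
  forall (R : realType) (d : Order.disp_t) (S : ctbDistrLatticeType d)
    (mu : S -> R) (rho lam : nat -> S -> R) (B : nat),
  fin_additive mu -> (forall s, 0 <= mu s <= 1) -> mu \top%O = 1 ->
  (forall n, fin_additive (rho n)) -> (forall p, fin_additive (lam p)) ->
  (forall n p, product_defined mu (rho n) (lam p)) ->
  (0 < B)%N ->
  (forall n, bounded_fluctuations (fun p => lim_product mu (rho n) (lam p))
               (fun E => 8 * B ^ 2 * E ^ 2)%N) ->
  (forall p, bounded_fluctuations (fun n => lim_product mu (rho n) (lam p))
               (fun E => 8 * B ^ 2 * E ^ 2)%N) ->
  (forall n, exists2 omega, modulus_of_continuity mu (rho n) omega &
     forall E, (0 < E)%N -> (omega E <= E * 2 ^ n)%N) ->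
  (forall p, exists2 omega, modulus_of_continuity mu (lam p) omega &
     forall E, (0 < E)%N -> (omega E <= E * 2 ^ p)%N) ->
  (forall n, (L1_norm (rho n) <= (B%:R)%:E)%E) ->
  (forall p, (L1_norm (lam p) <= (B%:R)%:E)%E) ->
  (forall E D : nat, (0 < E)%N -> (0 < D)%N ->
   forall nu : S -> R,
     (exists n, nu = rho n) \/ (exists p, nu = lam p) ->
   forall Bp : {fset S}, is_partition Bp ->
   exists Bp' Bp'' : {fset S},
     [/\ is_partition Bp', refined_by Bp Bp', (Bp'' `<=` Bp')%fset,
         E_constant mu E nu (Bp' `\` Bp'')%fset &
         sum_on mu Bp'' < D%:R^-1 /\
         (#|` Bp'| <= 2 * B * D * E * #|` Bp|)%N]) ->
  forall E : nat, (0 < E)%N ->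
  exists m s q l : nat,
    [/\ (m < s)%N, (q < l)%N,
        (s <= iter (cstC B E + 2) (w_fun a i B E (2 ^ 20 * B ^ 4 * E ^ 4)) 1)%N,
        (l <= iter (cstC B E + 2) (w_fun a i B E (2 ^ 20 * B ^ 4 * E ^ 4)) 1)%N &
        `|lim_product mu (rho m) (lam s) \top%O - lim_product mu (rho l) (lam q) \top%O|
          < 20%:R / E%:R].
Proof.
(* The exponent 60 is that of [growth_bound]. *)
pose a (x y z : nat) := (2 ^ ((x * y * z) ^ 60))%N; pose i (_ _ _ _ : nat) := 0%N.
exists a, i; split.
  by exists (fun x => 2 ^ (x ^ 60))%N => //; exists 2%N, 1%N, 60%N, 0%N => x; rewrite mul1n addn0.
split; first by exists (fun=> 0%N) => //; exists 0%N, 0%N, 0%N, 0%N.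
move=> R d S mu rho lam B mu_add mu01 _ rho_add lam_add prod B0 fl_lam fl_rho
  mod_rho mod_lam rhoB lamB _ E E0.
set J := (2 ^ 20 * B ^ 4 * E ^ 4)%N.
pose L := w_fun a i B E J 1.
have infl x : (x <= w_fun a i B E J x)%N by apply: large_le (large_w_fun a i B E J x).
have LL : (L <= iter (cstC B E + 2) (w_fun a i B E J) 1)%N by rewrite addn2; apply: le_iter_infl.
have C0 : (0 < cstC B E ^ 2)%N.
  by rewrite expn_gt0 /cstC muln_gt0 muln_gt0 !expn_gt0 B0 E0.
have steps_mono : {homo energy_steps B E : u v / (u <= v)%N} by apply: energy_steps_homo.
(* Two levels are spent on each of the [hump_count] humps. *)
have rJ : (2 * hump_count B E <= J)%N.
  apply: (@leq_trans (2 ^ 8 * (B ^ 4 * E ^ 4))).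
    have x0 : (0 < B ^ 2 * E ^ 2)%N by rewrite muln_gt0 !expn_gt0 B0 E0.
    have -> : (B ^ 4 * E ^ 4 = (B ^ 2 * E ^ 2) * (B ^ 2 * E ^ 2))%N by rewrite mulnACA -!expnD.
    by rewrite /hump_count main_flucE; move: (B ^ 2 * E ^ 2)%N x0 => x x0; nia.
  by rewrite /J -mulnA leq_mul2r leq_exp2l // orbT.
have lg : large (fun t => growth (main_fluc B E) (fine_fluc B E) (energy_steps B E) t ^ hump_count B E)%N
    (fun s => (1 < s <= L)%N) (2 * hump_count B E) 1 L.
  apply: large_level rJ _; [exact: growth_homo|exact: growth_gt0|].
  apply: large_sub (large_w_fun a i B E J 1) => //; first exact: growth_homo.
  move=> t t0; apply: leq_trans (growth_bound B0 E0 t0) _.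
  by rewrite /w_iterations mul0n addn0 leq_pmulr.
have e0 : 0 < (6 * fine_scale B E)%:R^-1 :> R by apply: e_gt0.
have [A0 A0P] := choice (fun np : nat * nat => lim_product_approx \top%O (prod np.1 np.2) e0).
(* One partition for each pair of indices up to [L]; their common refinement [P] approximates all
   these products at once. *)
pose l := [seq A0 (n, p) | n <- iota 0 L.+1, p <- iota 0 L.+1].
have [A /allpairsP[np [_ _ ->]]|P [pP bP jP Pl]] := @common_refinement_seq _ S l.
  by have [pA rA _] := A0P (np.1, np.2); split=> //; rewrite -rA.1 big_seq_fset1.
have approx n p : (n <= L)%N -> (p <= L)%N -> forall A, is_partition A -> refined_by P A ->
    `|lim_product mu (rho n) (lam p) \top%O - sum_on (star_product mu (rho n) (lam p)) A| <
      (6 * fine_scale B E)%:R^-1.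
  move=> nL pL A pA rA; have [_ _] := A0P (n, p); apply=> //.
  apply: refined_trans rA; apply: Pl; apply/allpairsP; exists (n, p).
  by rewrite !mem_iota /= !add0n !ltnS nL pL.
have [n [q [p [nq qp pL lt]]]] := model_pair mu01 rho_add prod B0 fl_lam fl_rho
  mod_rho mod_lam rhoB lamB E0 pP bP jP approx lg.
(* The middle index [q] serves as both [s] and [q], with [m = n] and [l = p]. *)
exists n, q, q, p; split=> //; last exact: leq_trans pL LL.
exact: leq_trans (ltnW (leq_trans qp pL)) LL.
Qed.
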